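(* Let $(M,\mathfrak g,f)$ be an $n$-Lie algebra in $\mathcal{LM}$ and let $(V,W,\varphi)$ be a representation of $(M,\mathfrak g,f)$ with structure maps $(\rho_1,\rho_2,\rho_3)$. Then there is a one-to-one correspondence between equivalence classes of abelian extensions of $(M,\mathfrak g,f)$ by $(V,W,\varphi)$ (inducing the representation $(\rho_1,\rho_2,\rho_3)$) and elements of the second cohomology group $H^2((M,\mathfrak g,f),(V,W,\varphi))$.
   Context: All vector spaces are over a fixed field, $n\ge2$; a linear map out of $\wedge^k$ is the same as an alternating $k$-linear map. **$n$-Lie algebras, representations.** An $n$-Lie algebra is a vector space $\mathfrak g$ with a linear map $[\cdot,\dots,\cdot]:\wedge^n\mathfrak g\to\mathfrak g$ with $[x_1,\dots,x_{n-1},[y_1,\dots,y_n]]=\sum_{i=1}^n[y_1,\dots,[x_1,\dots,x_{n-1},y_i],\dots,y_n]$. A representation of $\mathfrak g$ on $V$ is a linear map $\rho:\wedge^{n-1}\mathfrak g\to\mathfrak{gl}(V)$ with (R1) $[\rho(x_1,\dots,x_{n-1}),\rho(y_1,\dots,y_{n-1})]=\sum_{i=1}^{n-1}\rho(y_1,\dots,[x_1,\dots,x_{n-1},y_i],\dots,y_{n-1})$; (R2) $\rho(x_1,\dots,x_{n-2},[y_1,\dots,y_n])=\sum_{i=1}^n(-1)^{n-i}\rho(y_1,\dots,\widehat{y_i},\dots,y_n)\rho(x_1,\dots,x_{n-2},y_i)$. **$n$-Lie algebras in $\mathcal{LM}$.** $(M,\mathfrak g,f)$ consists of an $n$-Lie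 algebra $\mathfrak g$, a representation $(M,\rho)$ of $\mathfrak g$ and a linear map $f:M\to\mathfrak g$ with $f(\rho(x_1,\dots,x_{n-1})(m))=[x_1,\dots,x_{n-1},f(m)]$. A homomorphism $(M,\mathfrak g,f)\to(M',\mathfrak g',f')$ is a pair $(\phi_0,\phi_1)$ of linear maps, where $\phi_0:\mathfrak g\to\mathfrak g'$ preserves $n$-brackets and $\phi_1:M\to M'$, with $f'\phi_1=\phi_0f$ and $\phi_1(\rho(x_1,\dots,x_{n-1})(m))=\rho'(\phi_0(x_1),\dots,\phi_0(x_{n-1}))(\phi_1(m))$. **Representations of $(M,\mathfrak g,f)$.** A representation is a linear map $\varphi:V\to W$ with representations $\rho_1$ of $\mathfrak g$ on $V$ and $\rho_2$ of $\mathfrak g$ on $W$ and a linear map $\rho_3:\mathfrak g^{\otimes(n-2)}\otimes M\to\mathrm{Hom}(W,V)$ such that, for all $x_j,y_j\in\mathfrak g$, $m\in M$, $v\in V$, $w\in W$ (with $x=(x_1,\dots,x_{n-1})$, $y=(y_1,\dots,y_{n-1})$): (a) $\varphi(\rho_1(x)(v))=\rho_2(x)(\varphi(v))$; (b) $\varphi(\rho_3(x_1,\dots,x_{n-2},m)(w))=\rho_2(x_1,\dots,x_{n-2},f(m))(w)$; (c) $\rho_1(x)\rho_3(y_1,\dots,y_{n-2},m)(w)=\rho_3(y_1,\dots,y_{n-2},\rho(x)(m))(w)+\rho_3(y_1,\dots,y_{n-2},m)\rho_2(x)(w)+\sum_{i=1}^{n-2}\rho_3(y_1,\dots,[x_1,\dots,x_{n-1},y_i],\dots,y_{n-2},m)(w)$;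 (d) $\rho_3(x_1,\dots,x_{n-2},\rho(y)(m))(w)=\rho_1(y)\rho_3(x_1,\dots,x_{n-2},m)(w)+\sum_{i=1}^{n-1}(-1)^{n-i}\rho_3(y_1,\dots,\widehat{y_i},\dots,y_{n-1},m)\rho_2(x_1,\dots,x_{n-2},y_i)(w)$; (e) (if $n\ge3$) $\rho_3(x_1,\dots,x_{n-3},[y_1,\dots,y_n],m)(w)=\sum_{i=1}^n(-1)^{n-i}\rho_1(y_1,\dots,\widehat{y_i},\dots,y_n)\rho_3(x_1,\dots,x_{n-3},y_i,m)(w)$; (f) $\rho_3(x_1,\dots,x_{n-2},m)\rho_2(y)(w)=\rho_1(y)\rho_3(x_1,\dots,x_{n-2},m)(w)+\sum_{i=1}^{n-1}(-1)^{n-i}\rho_3(y_1,\dots,\widehat{y_i},\dots,y_{n-1},\rho(x_1,\dots,x_{n-2},y_i)(m))(w)$. **Abelian extensions.** An extension of $(M,\mathfrak g,f)$ by an $n$-Lie algebra $(V,W,\varphi)$ in $\mathcal{LM}$ is an $n$-Lie algebra $(\widehat M,\widehat{\mathfrak g},\widehat f)$ in $\mathcal{LM}$ (with action $\widehat\rho$) and homomorphisms $i=(i_0,i_1):(V,W,\varphi)\to(\widehat M,\widehat{\mathfrak g},\widehat f)$, $p=(p_0,p_1):(\widehat M,\widehat{\mathfrak g},\widehat f)\to(M,\mathfrak g,f)$ such that $0\to V\xrightarrow{i_1}\widehat M\xrightarrow{p_1}M\to0$ and $0\to W\xrightarrow{i_0}\widehat{\mathfrak g}\xrightarrow{p_0}\mathfrak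 g\to0$ are exact; identify $V,W$ with their images. It is abelian if $(V,W,\varphi)$ is abelian, i.e. $\varphi:V\to W$ is a linear map of vector spaces, with zero bracket on $W$ and trivial action of $W$ on $V$. Two extensions $(\widehat M,\widehat{\mathfrak g},\widehat f;i,p)$ and $(\widetilde M,\widetilde{\mathfrak g},\widetilde f;j,q)$ are equivalent if there is a homomorphism $F$ from the first to the second with $F\circ i=j$ and $q\circ F=p$. A splitting is a pair of linear maps $\sigma_0:\mathfrak g\to\widehat{\mathfrak g}$, $\sigma_1:M\to\widehat M$ with $p_0\sigma_0=\mathrm{id}$, $p_1\sigma_1=\mathrm{id}$. The representation induced by an abelian extension is given, via a splitting, by $\rho_1(x)(v)=\widehat\rho(\sigma_0(x_1),\dots,\sigma_0(x_{n-1}))(v)$, $\rho_2(x)(w)=[\sigma_0(x_1),\dots,\sigma_0(x_{n-1}),w]_{\widehat{\mathfrak g}}$, $\rho_3(x_1,\dots,x_{n-2},m)(w)=-\widehat\rho(\sigma_0(x_1),\dots,\sigma_0(x_{n-2}),w)(\sigma_1(m))$. **Second cohomology.** A 2-cochain is a triple $(\omega,\nu,\theta)$ of linear maps $\omega:\wedge^n\mathfrak g\to W$, $\nu:\wedge^{n-1}\mathfrak g\otimes M\to V$, $\theta:M\to W$. It is a 2-cocycle if for all $x_j,y_j\in\mathfrak g$, $m\in M$: (Z1) $\theta(\rho(x)(m))+\varphi(\nu(x,m))=\omega(x_1,\dots,x_{n-1},f(m))+\rho_2(x)(\theta(m))$; (Z2) $\omega(x_1,\dots,x_{n-1},[y_1,\dots,y_n])+\rho_2(x)\omega(y_1,\dots,y_n)=\sum_{i=1}^n\omega(y_1,\dots,[x_1,\dots,x_{n-1},y_i],\dots,y_n)+\sum_{i=1}^n(-1)^{n-i}\rho_2(y_1,\dots,\widehat{y_i},\dots,y_n)\omega(x_1,\dots,x_{n-1},y_i)$;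 (Z3) $\nu(x,\rho(y)(m))+\rho_1(x)\nu(y,m)=\sum_{i=1}^{n-1}\nu(y_1,\dots,[x_1,\dots,x_{n-1},y_i],\dots,y_{n-1},m)+\nu(y,\rho(x)(m))+\sum_{i=1}^{n-1}[y_1,\dots,\omega(x_1,\dots,x_{n-1},y_i),\dots,y_{n-1},m]+\rho_1(y)\nu(x,m)$. Here, for $w\in W$ in the $i$-th slot, $[y_1,\dots,w,\dots,y_{n-1},m]:=(-1)^{n-i}\rho_3(y_1,\dots,\widehat{y_i},\dots,y_{n-1},m)(w)$. For linear maps $b_0:\mathfrak g\to W$, $b_1:M\to V$, the coboundary $D(b_0,b_1)=(\omega,\nu,\theta)$ is given by $\theta=\varphi b_1-b_0f$, $\omega(x_1,\dots,x_n)=\sum_{i=1}^n(-1)^{n-i}\rho_2(x_1,\dots,\widehat{x_i},\dots,x_n)(b_0(x_i))-b_0([x_1,\dots,x_n])$, $\nu(x,m)=\sum_{i=1}^{n-1}[x_1,\dots,b_0(x_i),\dots,x_{n-1},m]+\rho_1(x)(b_1(m))-b_1(\rho(x)(m))$. $H^2((M,\mathfrak g,f),(V,W,\varphi))$ is the space of 2-cocycles modulo the space of coboundaries.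
   Formalization: For n≥3, 2-cocycles must also satisfy the (R2)-type identity for the twisted action, ''abelian'' means every operation with two arguments in (V,W) vanishes, and ρ_3 is taken alternating in its 𝔤-arguments; as literally stated the correspondence fails. *)

(* Defs.v *)
From mathcomp Require Import all_boot all_order all_algebra.

Set Implicit Arguments.
Unset Strict Implicit.
Unset Printing Implicit Defensive.

Import GRing.Theory.
Local Open Scope ring_scope.

(* The arity is n = k + 2, so that n >= 2 is built in: arguments of the
   n-bracket are families indexed by 'I_k.+2, those of a representation are
   indexed by 'I_k.+1 and the first arguments of rho_3 by 'I_k.  Indices start
   at 0, hence the sign (-1)^(n-i) attached to the i-th argument, 1 <= i, is
   (-1) ^+ (k.+1 - i) here, abbreviated to sgn i. *)

Section Families.
Variable T : Type.

Definition setarg k (x : 'I_k -> T) (i : 'I_k) (a : T) : 'I_k -> T :=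
  fun j => if j == i then a else x j.

Definition omit k (x : 'I_k.+1 -> T) (i : 'I_k.+1) : 'I_k -> T :=
  fun j => x (lift i j).

(* (x_1, ..., x_k, a) *)
Definition snoc k (x : 'I_k -> T) (a : T) : 'I_k.+1 -> T :=
  fun j => if unlift ord_max j is Some j' then x j' else a.

End Families.

Definition multilinear (K : fieldType) (U V : lmodType K) k
    (F : ('I_k -> U) -> V) : Prop :=
  forall x i, linear (fun u => F (setarg x i u)).

Definition alternating (K : fieldType) (U V : lmodType K) k
    (F : ('I_k -> U) -> V) : Prop :=
  forall x i j, i != j -> x i = x j -> F x = 0.

(* The elements of the quotient of T by an equivalence relation R, as the
   equivalence classes. *)
Definition classes (T : Type) (R : T -> T -> Prop) :=
  {A : T -> Prop | exists x, A = R x}.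

Section NLie.
Variables (K : fieldType) (k : nat).

Local Notation sgn i := ((-1) ^+ (k.+1 - i)%N).

Record is_nlie (g : lmodType K) (br : ('I_k.+2 -> g) -> g) : Prop := IsNLie {
  nlie_multilinear : multilinear br;
  nlie_alternating : alternating br;
  nlie_fundamental : forall (x : 'I_k.+1 -> g) (y : 'I_k.+2 -> g),
    br (snoc x (br y)) = \sum_i br (setarg y i (br (snoc x (y i))))
}.

Record is_rep (g : lmodType K) (br : ('I_k.+2 -> g) -> g)
    (V : lmodType K) (rho : ('I_k.+1 -> g) -> V -> V) : Prop := IsRep {
  rep_linear : forall x, linear (rho x);
  rep_multilinear : forall v, multilinear (fun x => rho x v);
  rep_alternating : forall v, alternating (fun x => rho x v);
  rep_R1 : forall (x y : 'I_k.+1 -> g) (v : V),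
    rho x (rho y v) - rho y (rho x v)
    = \sum_i rho (setarg y i (br (snoc x (y i)))) v;
  rep_R2 : forall (x : 'I_k -> g) (y : 'I_k.+2 -> g) (v : V),
    rho (snoc x (br y)) v
    = \sum_(i < k.+2) sgn i *: rho (omit y i) (rho (snoc x (y i)) v)
}.

Record nlieLM := NLieLM {
  lmM : lmodType K;
  lmg : lmodType K;
  lmbr : ('I_k.+2 -> lmg) -> lmg;
  lmrho : ('I_k.+1 -> lmg) -> lmM -> lmM;
  lmf : {linear lmM -> lmg};
  lm_nlie : is_nlie lmbr;
  lm_rep : is_rep lmbr lmrho;
  lm_equiv : forall x m, lmf (lmrho x m) = lmbr (snoc x (lmf m))
}.

Record is_LMhom (L L' : nlieLM)
    (phi0 : lmg L -> lmg L') (phi1 : lmM L -> lmM L') : Prop := IsLMhom {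
  hom_linear0 : linear phi0;
  hom_linear1 : linear phi1;
  hom_br : forall x, phi0 (lmbr x) = lmbr (phi0 \o x);
  hom_f : forall m, lmf L' (phi1 m) = phi0 (lmf L m);
  hom_rho : forall x m, phi1 (lmrho x m) = lmrho (phi0 \o x) (phi1 m)
}.

(* Axioms (a)-(f) of a representation of (M, g, f).  rho_3 is required to be
   alternating in its arguments from g: it is so when it is induced by an
   extension, and otherwise the coboundaries below would not be cochains.
   Axiom (e) concerns the last of these arguments, if there is one. *)
Record is_LMrep (L : nlieLM) (V W : lmodType K) (phi : V -> W)
    (rho1 : ('I_k.+1 -> lmg L) -> V -> V)
    (rho2 : ('I_k.+1 -> lmg L) -> W -> W)
    (rho3 : ('I_k -> lmg L) -> lmM L -> W -> V) : Prop := IsLMrep {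
  LMrep_rho1 : is_rep (@lmbr L) rho1;
  LMrep_rho2 : is_rep (@lmbr L) rho2;
  rho3_linearW : forall x m, linear (rho3 x m);
  rho3_linearM : forall x w, linear (fun m => rho3 x m w);
  rho3_multilinear : forall m w, multilinear (fun x => rho3 x m w);
  rho3_alternating : forall m w, alternating (fun x => rho3 x m w);
  LMrep_a : forall x v, phi (rho1 x v) = rho2 x (phi v);
  LMrep_b : forall x m w, phi (rho3 x m w) = rho2 (snoc x (lmf L m)) w;
  LMrep_c : forall x y m w,
    rho1 x (rho3 y m w)
    = rho3 y (lmrho x m) w + rho3 y m (rho2 x w)
      + \sum_i rho3 (setarg y i (lmbr (snoc x (y i)))) m w;
  LMrep_d : forall x y m w,
    rho3 x (lmrho y m) w
    = rho1 y (rho3 x m w)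
      + \sum_(i < k.+1) sgn i *: rho3 (omit y i) m (rho2 (snoc x (y i)) w);
  LMrep_e : forall (x : 'I_k -> lmg L) (j : 'I_k) (y : 'I_k.+2 -> lmg L) m w,
    j.+1 = k ->
    rho3 (setarg x j (lmbr y)) m w
    = \sum_(i < k.+2) sgn i *: rho1 (omit y i) (rho3 (setarg x j (y i)) m w);
  LMrep_f : forall x y m w,
    rho3 x m (rho2 y w)
    = rho1 y (rho3 x m w)
      + \sum_(i < k.+1) sgn i *: rho3 (omit y i) (lmrho (snoc x (y i)) m) w
}.

Record extension (L A : nlieLM) := Extension {
  ext_hat :> nlieLM;
  ext_i0 : lmg A -> lmg ext_hat;
  ext_i1 : lmM A -> lmM ext_hat;
  ext_p0 : lmg ext_hat -> lmg L;
  ext_p1 : lmM ext_hat -> lmM L;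
  ext_ihom : is_LMhom ext_i0 ext_i1;
  ext_phom : is_LMhom ext_p0 ext_p1;
  ext_i0_inj : injective ext_i0;
  ext_i1_inj : injective ext_i1;
  ext_exact0 : forall a, ext_p0 a = 0 <-> exists w, ext_i0 w = a;
  ext_exact1 : forall a, ext_p1 a = 0 <-> exists v, ext_i1 v = a;
  ext_p0_surj : forall x, exists a, ext_p0 a = x;
  ext_p1_surj : forall m, exists a, ext_p1 a = m
}.

Definition ext_equiv (L A : nlieLM) (E E' : extension L A) : Prop :=
  exists (F0 : lmg E -> lmg E') (F1 : lmM E -> lmM E'),
  [/\ is_LMhom F0 F1,
      forall w, F0 (ext_i0 E w) = ext_i0 E' w,
      forall v, F1 (ext_i1 E v) = ext_i1 E' v,
      forall a, ext_p0 (F0 a) = ext_p0 a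
    & forall a, ext_p1 (F1 a) = ext_p1 a].

Record is_splitting (L A : nlieLM) (E : extension L A)
    (s0 : lmg L -> lmg E) (s1 : lmM L -> lmM E) : Prop := IsSplitting {
  splitting_linear0 : linear s0;
  splitting_linear1 : linear s1;
  splitting_p0 : forall x, ext_p0 (s0 x) = x;
  splitting_p1 : forall m, ext_p1 (s1 m) = m
}.

Section Abelian.
Variables (V W : lmodType K) (phi : {linear V -> W}).

Lemma abelian_nlie : is_nlie (fun _ : 'I_k.+2 -> W => 0 : W).
Proof.
split=> [x i a u v|//|x y]; first by rewrite scaler0 addr0.
by rewrite big1.
Qed.

Lemma abelian_rep :
  is_rep (fun _ : 'I_k.+2 -> W => 0 : W)
         (fun (_ : 'I_k.+1 -> W) (_ : V) => 0 : V).
Proof.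
split=> [x a u v|v x i a u u'|//|x y v|x y v].
- by rewrite scaler0 addr0.
- by rewrite scaler0 addr0.
- by rewrite subr0 big1.
- by rewrite big1 // => i _; rewrite scaler0.
Qed.

Lemma abelian_equiv (x : 'I_k.+1 -> W) (v : V) : phi 0 = 0.
Proof. exact: linear0. Qed.

Definition abelianLM : nlieLM := NLieLM abelian_nlie abelian_rep abelian_equiv.

(* (V, W, phi) is abelian inside the extension: in hat M and hat g, every
   operation having at least two arguments in (V, W) vanishes.  For n = 2 this
   says no more than that the bracket of W and the action of W on V are zero.
   For n > 2 the vanishing of [w_1, ..., w_n] and of
   rho(w_1, ..., w_(n-1))(v) alone would not make the induced representation
   independent of the splitting. *)
Record is_abelian_ideal (L : nlieLM) (E : extension L abelianLM) : Prop :=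
  IsAbelianIdeal {
  ideal_WW : forall (x : 'I_k.+2 -> lmg E) i j w w', i != j ->
    x i = ext_i0 E w -> x j = ext_i0 E w' -> lmbr x = 0;
  ideal_WV : forall (x : 'I_k.+1 -> lmg E) i w v,
    x i = ext_i0 E w -> lmrho x (ext_i1 E v) = 0;
  ideal_WWM : forall (x : 'I_k.+1 -> lmg E) i j w w' m, i != j ->
    x i = ext_i0 E w -> x j = ext_i0 E w' -> lmrho x m = 0
}.

Variable L : nlieLM.
Local Notation g := (lmg L).
Local Notation M := (lmM L).
Local Notation f := (lmf L).
Variables (rho1 : ('I_k.+1 -> g) -> V -> V) (rho2 : ('I_k.+1 -> g) -> W -> W).
Variable rho3 : ('I_k -> g) -> M -> W -> V.

Definition induces (E : extension L abelianLM) : Prop :=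
  exists (s0 : g -> lmg E) (s1 : M -> lmM E),
  [/\ is_splitting s0 s1,
      forall x v, ext_i1 E (rho1 x v) = lmrho (s0 \o x) (ext_i1 E v),
      forall x w, ext_i0 E (rho2 x w) = lmbr (snoc (s0 \o x) (ext_i0 E w))
    & forall x m w,
        ext_i1 E (rho3 x m w) = - lmrho (snoc (s0 \o x) (ext_i0 E w)) (s1 m)].

Record abelian_extension := AbelianExtension {
  aext :> extension L abelianLM;
  aext_ideal : is_abelian_ideal aext;
  aext_induces : induces aext
}.

Definition extension_class :=
  classes (fun E E' : abelian_extension => ext_equiv E E').

Record cochain := Cochain {
  com : ('I_k.+2 -> g) -> W;
  cnu : ('I_k.+1 -> g) -> M -> V;
  cth : M -> W;
  com_multilinear : multilinear com;
  com_alternating : alternating com;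
  cnu_multilinear : forall m, multilinear (fun x => cnu x m);
  cnu_alternating : forall m, alternating (fun x => cnu x m);
  cnu_linear : forall x, linear (cnu x);
  cth_linear : linear cth
}.

(* [y_1, ..., w, ..., y_(n-1), m] with w in the i-th slot *)
Definition slot (y : 'I_k.+1 -> g) (i : 'I_k.+1) (w : W) (m : M) : V :=
  sgn i *: rho3 (omit y i) m w.

(* cocycle_act1 and cocycle_act2 express the two defining identities of a
   representation (rep_R1 and rep_R2) for the action on hat M = M + V twisted
   by nu and omega.  They are equivalent when n = 2, but cocycle_act2 does not
   follow from the other conditions when n > 2: take n = 3, g = K^4 abelian,
   M = K, rho = 0, f = 0, W = 0, V = K^2, rho_1(x) = beta(x) N with beta a
   symplectic form, N e_1 = e_2 and N e_2 = 0, and nu(x, 1) = beta(x) e_1. *)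
Record is_cocycle (c : cochain) : Prop := IsCocycle {
  cocycle_f : forall x m,
    cth c (lmrho x m) + phi (cnu c x m)
    = com c (snoc x (f m)) + rho2 x (cth c m);
  cocycle_br : forall x y,
    com c (snoc x (lmbr y)) + rho2 x (com c y)
    = \sum_i com c (setarg y i (lmbr (snoc x (y i))))
      + \sum_(i < k.+2) sgn i *: rho2 (omit y i) (com c (snoc x (y i)));
  cocycle_act1 : forall x y m,
    cnu c x (lmrho y m) + rho1 x (cnu c y m)
    = \sum_i cnu c (setarg y i (lmbr (snoc x (y i)))) m
      + cnu c y (lmrho x m)
      + \sum_i slot y i (com c (snoc x (y i))) m
      + rho1 y (cnu c x m);
  cocycle_act2 : forall (x : 'I_k -> g) (y : 'I_k.+2 -> g) m,
    cnu c (snoc x (lmbr y)) m - rho3 x m (com c y)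
    = \sum_(i < k.+2) sgn i *:
        (cnu c (omit y i) (lmrho (snoc x (y i)) m)
         + rho1 (omit y i) (cnu c (snoc x (y i)) m))
}.

Definition cocycle := {c : cochain | is_cocycle c}.

Section Coboundary.
Variables (b0 : g -> W) (b1 : M -> V).

Definition Dth (m : M) : W := phi (b1 m) - b0 (f m).

Definition Dom (x : 'I_k.+2 -> g) : W :=
  \sum_(i < k.+2) sgn i *: rho2 (omit x i) (b0 (x i)) - b0 (lmbr x).

Definition Dnu (x : 'I_k.+1 -> g) (m : M) : V :=
  \sum_i slot x i (b0 (x i)) m + rho1 x (b1 m) - b1 (lmrho x m).

End Coboundary.

Definition cohomologous (c c' : cochain) : Prop :=
  exists (b0 : {linear g -> W}) (b1 : {linear M -> V}),
  [/\ forall x, com c' x - com c x = Dom b0 x,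
      forall x m, cnu c' x m - cnu c x m = Dnu b0 b1 x m
    & forall m, cth c' m - cth c m = Dth b0 b1 m].

Definition H2 :=
  classes (fun c c' : cocycle => cohomologous (sval c) (sval c')).

(* c measures the failure of the splitting to be a homomorphism. *)
Definition splitting_cochain (E : extension L abelianLM)
    (s0 : g -> lmg E) (s1 : M -> lmM E) (c : cochain) : Prop :=
  [/\ forall x, ext_i0 E (com c x) = lmbr (s0 \o x) - s0 (lmbr x),
      forall x m, ext_i1 E (cnu c x m) = lmrho (s0 \o x) (s1 m) - s1 (lmrho x m)
    & forall m, ext_i0 E (cth c m) = lmf E (s1 m) - s0 (f m)].

End Abelian.

End NLie.

(* Main.v *)
(* Choosing a linear splitting identifies an abelian extension with g x W and
   M x V, on which the operations become those of the split extension twisted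
   by a cochain.  The axioms of an n-Lie algebra in LM hold for the twisted
   operations exactly when the cochain is a cocycle: this gives both the cocycle
   of an extension and the extension built from a cocycle.  A cochain c' is
   cohomologous to the cochain c of a splitting of E exactly when c' is the
   cochain of another splitting of E, and two extensions with splittings having
   the same cochain are equivalent. *)
From HB Require Import structures.
Require Import Defs.
From mathcomp Require Import all_boot all_order all_algebra.
From mathcomp Require Import boolp zify.
Import GRing.Theory.
Local Open Scope ring_scope.

Set Implicit Arguments.
Unset Strict Implicit.
Unset Printing Implicit Defensive.

(** The cocycle identities quantify over $\mathfrak g$ and $M$ only, whereas the axioms of the
    twisted operations quantify over pairs in $\mathfrak g\times W$ and $M\times V$. The gap is
    filled exactly by the axioms of a representation: expanding a twisted axiom, the terms carrying
    an entry of $W$ or $V$ match by (R1), (R2) and (a)-(f), and the terms carrying none form the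
    cocycle identity.

    The difficulty is bookkeeping. An entry of $W$ may stand in any slot of an operation of the
    extension. Multilinearity and the ideal conditions leave at most one such entry, alternation
    moves it to the last slot, and the resulting sign $(-1)^{n-i}$ is packed into the operator
    [insert], shared by the bracket and the action.

    Extensions and cocycles are matched by a relation (the cocycle comes from some splitting of the
    extension) rather than by a function, so independence of the splitting and the laws of both
    equivalence relations come out of the same few facts. *)

(** * Bijections between quotients induced by a relation *)

(** Through [S] the relation [R] inherits the equivalence laws from [R']. The image under [S] of a
    class of [R] is then a full class of [R'], and taking preimages is the inverse map. *)
Lemma classes_bijection (T T' : Type) (R : T -> T -> Prop)
    (R' : T' -> T' -> Prop) (S : T -> T' -> Prop) :
  (forall y, R' y y) -> (forall x y, R' x y -> R' y x) ->
  (forall x y z, R' x y -> R' y z -> R' x z) ->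
  (forall x, exists y, S x y) -> (forall y, exists x, S x y) ->
  (forall x x' y y', S x y -> S x' y' -> R x x' <-> R' y y') ->
  exists Phi : classes R -> classes R', bijective Phi /\
    forall A x y, sval A x -> S x y -> sval (Phi A) y.
Proof.
move=> reflR' symR' transR' totS surjS compat.
have reflR x : R x x by have [y Sxy] := totS x; apply/(compat _ _ _ _ Sxy Sxy).
have symR x x' : R x x' -> R x' x.
  have [[y Sxy] [y' Sxy']] := (totS x, totS x').
  by move/(compat _ _ _ _ Sxy Sxy')/symR'/(compat _ _ _ _ Sxy' Sxy).
have transR x1 x2 x3 : R x1 x2 -> R x2 x3 -> R x1 x3.
  have [[[y1 S1] [y2 S2]] [y3 S3]] := (totS x1, totS x2, totS x3).
  move=> /(compat _ _ _ _ S1 S2) R12 /(compat _ _ _ _ S2 S3) R23.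
  by apply/(compat _ _ _ _ S1 S3); apply: transR' R12 R23.
have imP (A : classes R) :
    exists y, (fun y => exists2 x, sval A x & S x y) = R' y.
  case: A => A [x0 eA]; subst A => /=; have [y0 S0] := totS x0; exists y0.
  apply/predeqP => y; split=> [[x R0x Sxy]|R0y]; first exact/(compat _ _ _ _ S0 Sxy).
  by have [x Sxy] := surjS y; exists x => //; apply/(compat _ _ _ _ S0 Sxy).
have preP (B : classes R') :
    exists x, (fun x => exists2 y, sval B y & S x y) = R x.
  case: B => B [y0 eB]; subst B => /=; have [x0 S0] := surjS y0; exists x0.
  apply/predeqP => x; split=> [[y R0y Sxy]|R0x]; first exact/(compat _ _ _ _ S0 Sxy).
  by have [y Sxy] := totS x; exists y => //; apply/(compat _ _ _ _ S0 Sxy).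
exists (fun A => exist (fun C => exists y, C = R' y) _ (imP A)); split;
  last by move=> A x y; exists x.
exists (fun B => exist (fun C => exists x, C = R x) _ (preP B))
  => [[A [x0 eA]]|[B [y0 eB]]].
  subst A; apply: eq_exist; apply/predeqP => x /=; split=> [[y [x' R0 S'] Sxy]|R0x].
    by apply: transR R0 _; apply/(compat _ _ _ _ S' Sxy).
  by have [y Sxy] := totS x; exists y => //; exists x.
subst B; apply: eq_exist; apply/predeqP => y /=; split=> [[x [y' R0 S'] Sxy]|R0y].
  by apply: transR' R0 _; apply/(compat _ _ _ _ S' Sxy).
by have [x Sxy] := surjS y; exists x => //; exists y.
Qed.

(** * Replacing, omitting and appending entries of a family *)

(** Nested [lift]s unfold to comparisons whose sides contain comparisons. Innermost ones are split
    first, so that [lia] meets pure arithmetic. *)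
Ltac bump_lia :=
  repeat match goal with
  | |- context [nat_of_bool (?a <= ?b)%N] =>
    lazymatch constr:((a, b)) with
    | context [nat_of_bool] => fail
    | _ => case: (leqP a b) => ?
    end
  end; lia.

Section Families.
Variable T : Type.
Implicit Types (n : nat) (a b : T).

Lemma setarg_eq n (x : 'I_n -> T) i a : setarg x i a i = a.
Proof. by rewrite /setarg eqxx. Qed.

Lemma setarg_neq n (x : 'I_n -> T) i j a : j != i -> setarg x i a j = x j.
Proof. by rewrite /setarg => /negPf->. Qed.

Lemma setarg_id n (x : 'I_n -> T) i : setarg x i (x i) = x.
Proof. by apply/funext => j; rewrite /setarg; case: eqP => [->|]. Qed.

Lemma setargC n (x : 'I_n -> T) i j a b : i != j ->
  setarg (setarg x i a) j b = setarg (setarg x j b) i a.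
Proof.
move=> nij; apply/funext => l; rewrite /setarg.
by case: eqP => // ->; rewrite eq_sym (negPf nij).
Qed.

Lemma setarg_omit n (x : 'I_n.+1 -> T) i a : omit (setarg x i a) i = omit x i.
Proof.
by apply/funext => j; rewrite /omit setarg_neq // eq_sym neq_lift.
Qed.

Lemma setarg_omit_lift n (x : 'I_n.+1 -> T) i j a :
  omit (setarg x (lift i j) a) i = setarg (omit x i) j a.
Proof.
by apply/funext => l; rewrite /omit /setarg (inj_eq (@lift_inj _ i)).
Qed.

Lemma snoc_max n (x : 'I_n -> T) a : snoc x a ord_max = a.
Proof. by rewrite /snoc unlift_none. Qed.

Lemma snoc_lift n (x : 'I_n -> T) a j : snoc x a (lift ord_max j) = x j.
Proof. by rewrite /snoc liftK. Qed.

Lemma ord_maxP n (i : 'I_n.+1) : i = ord_max \/ exists j, i = lift ord_max j.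
Proof. by case: (unliftP ord_max i) => [j ->|->]; [right; exists j|left]. Qed.

Lemma snocP n (x : 'I_n.+1 -> T) (y : 'I_n -> T) a :
  (forall j, x (lift ord_max j) = y j) -> x ord_max = a -> x = snoc y a.
Proof.
move=> xl xm; apply/funext => i.
by case: (ord_maxP i) => [->|[j ->]]; rewrite ?snoc_max ?snoc_lift.
Qed.

Lemma snoc_omit n (x : 'I_n.+1 -> T) : snoc (omit x ord_max) (x ord_max) = x.
Proof. by symmetry; apply: snocP. Qed.

Lemma omit_snoc n (x : 'I_n -> T) a : omit (snoc x a) ord_max = x.
Proof. by apply/funext => j; rewrite /omit snoc_lift. Qed.

Lemma setarg_snoc_max n (x : 'I_n -> T) a b :
  setarg (snoc x a) ord_max b = snoc x b.
Proof.
apply: snocP => [j|]; last by rewrite setarg_eq.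
by rewrite setarg_neq ?snoc_lift // eq_sym neq_lift.
Qed.

Lemma setarg_snoc_lift n (x : 'I_n -> T) j a b :
  setarg (snoc x a) (lift ord_max j) b = snoc (setarg x j b) a.
Proof.
apply: snocP => [l|]; last by rewrite setarg_neq ?snoc_max ?neq_lift.
by rewrite /setarg (inj_eq (@lift_inj _ _)) snoc_lift.
Qed.

Lemma omit_snoc_lift n (x : 'I_n.+1 -> T) a j :
  omit (snoc x a) (lift ord_max j) = snoc (omit x j) a.
Proof.
apply: snocP => [l|]; rewrite /omit.
  rewrite (_ : lift _ _ = lift ord_max (lift j l)) ?snoc_lift //.
  by apply: val_inj; rewrite /= /bump; have := ltn_ord j; have := ltn_ord l; bump_lia.
rewrite (_ : lift _ _ = ord_max) ?snoc_max //.
by apply: val_inj; rewrite /= /bump; have := ltn_ord j; bump_lia.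
Qed.

(* The shape required by axiom (e). *)
Lemma omit_snoc_setarg n (x : 'I_n -> T) (j : 'I_n) :
  exists (x' : 'I_n -> T) (j' : 'I_n), j'.+1 = n /\
    forall a, omit (snoc x a) (lift ord_max j) = setarg x' j' a.
Proof.
case: n x j => [|n] x j; first by case: j.
(* The last entry [x j] is a placeholder, overwritten by [a]. *)
exists (snoc (omit x j) (x j)), ord_max; split=> // a.
by rewrite omit_snoc_lift setarg_snoc_max.
Qed.

(* [(i, l)] stands for the entries [i] and [lift i l]; [swap_omit] lists them in
   the other order. *)
Definition swap_omit n (p : 'I_n.+2 * 'I_n.+1) : 'I_n.+2 * 'I_n.+1 :=
  (lift p.1 p.2, odflt p.2 (unlift (lift p.1 p.2) p.1)).

Lemma lift_swap_omit n (i : 'I_n.+2) l :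
  lift (swap_omit (i, l)).1 (swap_omit (i, l)).2 = i.
Proof.
(* The default value of [odflt] is never taken, since [i] differs from [lift i l]. *)
rewrite /swap_omit /=; case: (unliftP (lift i l) i) => [j <-//|/eqP].
by rewrite (negPf (neq_lift i l)).
Qed.

Lemma swap_omitK n : involutive (@swap_omit n).
Proof.
move=> [i l]; have h := lift_swap_omit i l.
have h' := lift_swap_omit (swap_omit (i, l)).1 (swap_omit (i, l)).2.
rewrite -surjective_pairing in h'.
have e1 : (swap_omit (swap_omit (i, l))).1 = i by [].
rewrite [LHS]surjective_pairing; move: h'; rewrite e1 => h'.
by congr (_, _); apply: (@lift_inj _ i).
Qed.

Lemma omit_omit_swap n (x : 'I_n.+2 -> T) i l :
  omit (omit x (swap_omit (i, l)).1) (swap_omit (i, l)).2 = omit (omit x i) l.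
Proof.
have h := lift_swap_omit i l.
apply/funext => j; rewrite /omit; congr x; apply: val_inj => /=.
have := congr1 val h; rewrite /= /bump; bump_lia.
Qed.

End Families.

(** * Linear, multilinear and alternating maps *)

Section LinearProp.
Variables (K : fieldType) (U V : lmodType K) (h : U -> V).
Hypothesis lin_h : linear h.

Let hL : {linear U -> V} :=
  HB.pack h (GRing.isLinear.Build K U V _ h lin_h).

Lemma lin0 : h 0 = 0. Proof. exact: (linear0 hL). Qed.
Lemma linD u v : h (u + v) = h u + h v. Proof. exact: (linearD hL). Qed.
Lemma linB u v : h (u - v) = h u - h v. Proof. exact: (linearB hL). Qed.
Lemma linN u : h (- u) = - h u. Proof. exact: (linearN hL). Qed.
Lemma linZ a u : h (a *: u) = a *: h u. Proof. exact: (linearZ_LR hL). Qed.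
Lemma lin_sum n (F : 'I_n -> U) : h (\sum_i F i) = \sum_i h (F i).
Proof. exact: (linear_sum hL). Qed.

(** Maps obtained by choice (cochains, coordinates, differences of splittings) are known only after
    an injection; this recovers their linearity. *)
Lemma linear_can (V' : lmodType K) (i : V' -> V) (h' : U -> V') :
  linear i -> injective i -> (forall u, i (h' u) = h u) -> linear h'.
Proof.
by move=> lin_i inj_i ih' a u v; apply: inj_i; rewrite lin_i !ih' lin_h.
Qed.

End LinearProp.

Lemma linear_sub (K : fieldType) (U V : lmodType K) (h h' : U -> V) :
  linear h -> linear h' -> linear (fun u => h u - h' u).
Proof. by move=> lh lh' a u v; rewrite lh lh' scalerBr opprD addrACA. Qed.

Section Multilinear.
Variables (K : fieldType) (U V : lmodType K).

Lemma update_seq n (G : ('I_n -> U) -> V) (a c : 'I_n -> U) (s : seq 'I_n) :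
  (forall x j, j \in s -> G (setarg x j (c j)) = G (setarg x j (a j))) ->
  G (fun j => if j \in s then c j else a j) = G a.
Proof.
elim: s => [|i s IHs] Gs /=; first by congr G; apply/funext.
rewrite -IHs; last by move=> x j js; apply: Gs; rewrite inE js orbT.
pose z j := if j \in s then c j else a j.
have zi : z = setarg z i (z i) by rewrite setarg_id.
have -> : (fun j => if j \in i :: s then c j else a j) = setarg z i (c i).
  by apply/funext => j; rewrite /setarg inE; case: eqP => [->|].
(* The list may repeat [i], in which case [z i] is already [c i]. *)
rewrite Gs ?mem_head // -/z [in RHS]zi /z.
by case: (i \in s) => //; rewrite Gs ?mem_head.
Qed.

Lemma multilinear_zero n (F : ('I_n -> U) -> V) :
  multilinear F -> forall x i, x i = 0 -> F x = 0.
Proof. by move=> linF x i x0; rewrite -(setarg_id x i) x0 (lin0 (linF x i)). Qed.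

Lemma multilinear_absorb n (F : ('I_n -> U) -> V) (B : U -> Prop) a b :
  multilinear F -> (forall x i, B (x i) -> F x = 0) ->
  (forall i, B (b i)) -> F (fun i => a i + b i) = F a.
Proof.
move=> linF F0 Bb; rewrite -(@update_seq _ F a (fun i => a i + b i) (enum 'I_n)).
  by congr F; apply/funext => j; rewrite mem_enum.
move=> x j _; rewrite (linD (linF x j)) [X in _ + X](F0 _ j) ?addr0 //.
by rewrite setarg_eq.
Qed.

(** Of the $2^n$ terms of the expansion, only those with at most one entry from [B] survive. *)
Lemma multilinear_expand n (F : ('I_n -> U) -> V) (B : U -> Prop) a b :
  multilinear F ->
  (forall x i j, i != j -> B (x i) -> B (x j) -> F x = 0) ->
  (forall i, B (b i)) ->
  F (fun i => a i + b i) = F a + \sum_i F (setarg a i (b i)).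
Proof.
move=> linF F0 Bb.
(* Induction on the set of perturbed slots; [uniq] ensures that a new slot still carries [a i]. *)
have expand s : uniq s -> F (fun j => if j \in s then a j + b j else a j)
    = F a + \sum_(i <- s) F (setarg a i (b i)).
  elim: s => [|i s IHs] /= => [_|/andP[nis us]].
    by rewrite big_nil addr0; congr F; apply/funext.
  pose z j := if j \in s then a j + b j else a j.
  have -> : (fun j => if j \in i :: s then a j + b j else a j)
      = setarg z i (a i + b i).
    by apply/funext => j; rewrite /setarg inE; case: eqP => [->|].
  have zi : a i = z i by rewrite /z (negPf nis).
  rewrite (linD (linF z i)) {1}zi setarg_id IHs // big_cons -addrA.
  congr (_ + _); rewrite addrC; congr (_ + _).
  (* With [b i] in slot [i], any further [b j] kills the term, so the other slots are reset to
     [a]. *)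
  rewrite (@update_seq _ (fun x => F (setarg x i (b i)))) // => x j js.
  have nji : j != i by apply: contraNneq nis => <-.
  rewrite !(setargC x _ _ nji) (linD (linF _ j)) [X in _ + X](F0 _ i j) ?addr0 //.
  - by rewrite eq_sym.
  - by rewrite setarg_neq ?setarg_eq // eq_sym.
  - by rewrite setarg_eq.
rewrite -(big_enum _ _ _) -expand ?enum_uniq //; congr F; apply/funext => j.
by rewrite mem_enum.
Qed.

Lemma multilinear_snoc n (F : ('I_n.+1 -> U) -> V) a :
  multilinear F -> multilinear (fun x => F (snoc x a)).
Proof.
move=> linF x i c u v /=; rewrite -!(setarg_snoc_lift _ i).
exact: linF.
Qed.

Lemma multilinear_comp (U' V' : lmodType K) n (F : ('I_n -> U) -> V)
    (s : U' -> U) (t : V -> V') :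
  linear s -> linear t -> multilinear F ->
  multilinear (fun x => t (F (s \o x))).
Proof.
move=> lin_s lin_t linF x i c u v.
have E w : s \o setarg x i w = setarg (s \o x) i (s w).
  by apply/funext => j; rewrite /= /setarg; case: eqP.
by rewrite !E lin_s linF lin_t.
Qed.

Section Alternating.
Variables (n : nat) (F : ('I_n.+1 -> U) -> V).
Hypotheses (linF : multilinear F) (altF : alternating F).

(** Polarisation: expand [F] with [x i + x j] in both slots. This works in every characteristic. *)
Lemma alternating_swap x i j : i != j ->
  F x = - F (setarg (setarg x i (x j)) j (x i)).
Proof.
move=> nij; have nji : j != i by rewrite eq_sym.
pose G u v := F (setarg (setarg x i u) j v).
have G0 u : G u u = 0.
  by apply: (altF nij); rewrite setarg_eq setarg_neq // setarg_eq.
have GDr u v w : G u (v + w) = G u v + G u w by apply: (linD (linF _ j)).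
have GDl u v w : G (u + v) w = G u w + G v w.
  by rewrite /G !(setargC x _ _ nij) (linD (linF _ i)).
have Fx : F x = G (x i) (x j) by rewrite /G !setarg_id.
have := G0 (x i + x j); rewrite GDr !GDl !G0 add0r addr0 addrC -Fx.
by move/eqP; rewrite addr_eq0 => /eqP.
Qed.

(** The entry travels to the end by [n - i] adjacent transpositions. *)
Lemma alternating_last x (i : 'I_n.+1) :
  F x = (-1) ^+ (n - i) *: F (snoc (omit x i) (x i)).
Proof.
move: {-2}(n - i)%N (erefl (n - i)%N) => d; elim: d x i => [|d IHd] x i nid.
  have -> : i = ord_max by apply: val_inj => /=; have := ltn_ord i; lia.
  by rewrite snoc_omit expr0 scale1r.
have ltin : (i.+1 < n.+1)%N by lia.
pose i' := Ordinal ltin.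
have nii' : i != i' by rewrite -val_eqE /= neq_ltn ltnSn.
rewrite (alternating_swap x nii') (IHd _ i') /=; last by lia.
rewrite exprS mulN1r scaleNr setarg_eq setarg_omit; congr (- (_ *: F (snoc _ _))).
apply/funext => j; rewrite /omit /setarg; case: eqP => [e|ne].
  congr x; apply: val_inj; move/(congr1 val): e; rewrite /= /bump.
  bump_lia.
congr x; apply: val_inj.
have: (lift i' j != i :> nat) by apply/eqP => e; apply: ne; apply: val_inj.
rewrite /= /bump; bump_lia.
Qed.

End Alternating.

End Multilinear.

Lemma comp_snoc (T T' : Type) (h : T -> T') n (x : 'I_n -> T) a :
  h \o snoc x a = snoc (h \o x) (h a).
Proof. by apply: snocP => [j|] /=; rewrite ?snoc_lift ?snoc_max. Qed.

Lemma comp_setarg (T T' : Type) (h : T -> T') n (x : 'I_n -> T) i a :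
  h \o setarg x i a = setarg (h \o x) i (h a).
Proof. by apply/funext => j; rewrite /= /setarg; case: eqP. Qed.

(** * The signed insertion of one entry of $W$ *)

Section Insert.
Variables (K : fieldType) (U V W : lmodType K).

(* For the semidirect product built from [G], this is the part of the bracket
   of the [x i + w i] that is linear in the [w i]. *)
Definition insert q p (G : ('I_p -> U) -> W -> V)
    (x : 'I_p.+1 -> U) (w : 'I_p.+1 -> W) : V :=
  \sum_(i < p.+1) (-1) ^+ (q - i) *: G (omit x i) (w i).

Variables (q p : nat).
Implicit Types (G : ('I_p -> U) -> W -> V) (x : 'I_p.+1 -> U) (w : 'I_p.+1 -> W).

Lemma insert0 G x : (forall z, linear (G z)) -> insert q G x (fun=> 0) = 0.
Proof.
by move=> linG; rewrite /insert big1 // => i _; rewrite (lin0 (linG _)) scaler0.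
Qed.

Lemma insert_zero G x w i j : (forall s, multilinear (fun z => G z s)) ->
  i != j -> x i = 0 -> x j = 0 -> insert q G x w = 0.
Proof.
move=> mulG nij xi xj; rewrite /insert big1 // => l _.
have [r xr] : exists r, omit x l r = 0.
  case: (unliftP l i) xi => [r -> xr|li _]; first by exists r.
  case: (unliftP l j) xj => [r -> xr|lj _]; first by exists r.
  by rewrite li lj eqxx in nij.
by rewrite (multilinear_zero (mulG _) xr) scaler0.
Qed.

(** The exponent bound [q] is separate from [p] because [rho2] and [rho3] share the exponents
    [k.+1 - i] although [rho3] takes one argument of $\mathfrak g$ fewer. The sign of the last term
    is therefore plus for [rho2] and minus for [rho3]. *)
Lemma insert_snoc G (x : 'I_p -> U) (w : 'I_p -> W) a b :
  insert q G (snoc x a) (snoc w b)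
  = (-1) ^+ (q - p) *: G x b
    + \sum_(i < p) (-1) ^+ (q - i) *: G (omit (snoc x a) (lift ord_max i)) (w i).
Proof.
rewrite /insert (@bigD1_ord _ _ _ _ ord_max) //= omit_snoc snoc_max; congr (_ + _).
apply: eq_bigr => i _; rewrite snoc_lift; congr ((-1) ^+ (q - _) *: _).
by rewrite /bump; have := ltn_ord i; bump_lia.
Qed.

(** This is the derivation sum of the fundamental identity, sorted by the slot that supplies the
    entry of $W$: the diagonal term changes that entry, the others act on the remaining
    arguments. *)
Lemma insert_setarg_sum G x w (a : 'I_p.+1 -> U) (b : 'I_p.+1 -> W) :
  \sum_i insert q G (setarg x i (a i)) (setarg w i (b i))
  = \sum_(i < p.+1) (-1) ^+ (q - i) *:
      (G (omit x i) (b i)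
       + \sum_j G (setarg (omit x i) j (a (lift i j))) (w i)).
Proof.
rewrite exchange_big /=; apply: eq_bigr => i _.
rewrite (@bigD1_ord _ _ _ _ i) //= setarg_omit setarg_eq scalerDr scaler_sumr.
congr (_ + _); apply: eq_bigr => j _.
by rewrite setarg_omit_lift setarg_neq // neq_lift.
Qed.

Lemma insert_multilinear G :
  (forall z, linear (G z)) -> (forall s, multilinear (fun z => G z s)) ->
  multilinear (fun X : 'I_p.+1 -> (U * W)%type => insert q G (fst \o X) (snd \o X)).
Proof.
move=> linG mulG X i c u v; rewrite !comp_setarg /insert scaler_sumr -big_split.
apply: eq_bigr => j _ /=; rewrite scalerA mulrC -scalerA -scalerDr.
congr (_ *: _); case: (unliftP j i) => [l ->|<-].
  by rewrite !setarg_omit_lift !setarg_neq ?neq_lift // mulG.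
by rewrite !setarg_omit !setarg_eq linG.
Qed.

End Insert.

(** If entries [i] and [j] agree, every term omitting neither vanishes by alternation of [G], and
    the two remaining terms cancel. The bound [p <= q] keeps the exponents from being truncated. *)
Lemma insert_alternating (K : fieldType) (U V W : lmodType K) q p
    (G : ('I_p -> U) -> W -> V) : (p <= q)%N ->
  (forall w, multilinear (fun x => G x w)) ->
  (forall w, alternating (fun x => G x w)) ->
  alternating (fun X : 'I_p.+1 -> (U * W)%type => insert q G (fst \o X) (snd \o X)).
Proof.
move=> lepq mulG altG X i j nij eij.
case: p lepq G X i j nij eij mulG altG => [|p] lepq G X i j nij eij mulG altG.
  by move: nij; rewrite !ord1.
have [l jE] : exists l : 'I_p.+1, j = lift i l.
  by case: (unliftP i j) nij => [l ->|->]; [exists l|rewrite eqxx].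
pose l' := (swap_omit (i, l)).2.
have iE : i = lift j l' by rewrite jE -[LHS](lift_swap_omit i l).
have dbl : omit (omit (fst \o X) j) l' = omit (omit (fst \o X) i) l.
  by rewrite jE; apply: (omit_omit_swap (fst \o X) i l).
rewrite /insert (bigD1 i) //= (bigD1 j) /=; last by rewrite eq_sym.
rewrite [X in _ + (_ + X)]big1 ?addr0.
  (* Once the surviving copy of the repeated entry is moved last, both terms have the same value and
     exponents of opposite parity. *)
  rewrite -eij (alternating_last (mulG _) (altG _) (omit (fst \o X) i) l).
  rewrite (alternating_last (mulG _) (altG _) (omit (fst \o X) j) l') -dbl.
  rewrite /omit /= -jE -iE -eij !scalerA -scalerDl; apply/eqP.
  rewrite -!exprD (_ : (-1) ^+ _ = - (-1) ^+ (q - j + (p - l'))) ?addNr ?scale0r //.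
  have := ltn_ord l; have := ltn_ord l'; have := ltn_ord i; have := ltn_ord j.
  have := congr1 val jE; have := congr1 val iE.
  rewrite /= /bump => vi vj *.
  rewrite -[RHS]mulN1r -exprS.
  case: (leqP i l) vj => il /= vj; case: (leqP j l') vi => jl /= vi; try lia.
    by congr (_ ^+ _); lia.
  rewrite (_ : (q - j + (p - l')).+1 = (q - i + (p - l)).+2); last by lia.
  by rewrite !exprS mulrA mulrNN !mul1r.
move=> r /andP[nri nrj].
case: (unliftP r i) nri nij eij => [i1 ->|->]; last by rewrite eqxx.
case: (unliftP r j) nrj => [j1 ->|->]; last by rewrite eqxx.
move=> _ _ nij eij; rewrite (altG _ _ i1 j1) ?scaler0 //.
  by apply: contra_neq nij => e; rewrite e.
by rewrite /omit /= eij.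
Qed.

(* Equalities of signed sums up to AC and cancellation; diverges when a summand
   is repeated. *)
Ltac zmod_AC :=
  apply/eqP; rewrite -subr_eq0 -[eqbLHS]addr0 ?(opprD, opprK) -?addrA;
  repeat lazymatch goal with
  | |- is_true (- ?b + _ == 0) => rewrite !(addrCA _ b) addNKr
  | |- is_true (?a + _ == 0) => rewrite !(addrCA _ (- a)) addKr
  end; exact: eqxx.

(** Both sides sum over ordered pairs of distinct slots. Exchanging the order of omission shifts
    exactly one of the two positions by one, whence the sign. The right-hand form is the one to
    which axiom (f) applies. *)
Lemma insert_omit_swap (K : fieldType) (U V W : lmodType K) q n
    (H : U -> ('I_n -> U) -> W -> V) (y : 'I_n.+2 -> U) (w : 'I_n.+2 -> W) :
  (n < q)%N ->
  \sum_(i < n.+2) (-1) ^+ (q - i) *: insert q (H (y i)) (omit y i) (omit w i)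
  = - \sum_(i < n.+2) (-1) ^+ (q - i) *:
      \sum_(l < n.+1) (-1) ^+ (q - l) *: H (omit y i l) (omit (omit y i) l) (w i).
Proof.
move=> ltnq; rewrite /insert.
under eq_bigr do rewrite scaler_sumr.
under [in RHS]eq_bigr do rewrite scaler_sumr.
rewrite -sumrN; under [in RHS]eq_bigr do rewrite -sumrN.
rewrite !pair_big /= (reindex_inj (inv_inj (@swap_omitK n))).
apply: eq_bigr => -[i l] _.
have h := lift_swap_omit i l.
rewrite omit_omit_swap !scalerA -scaleNr.
have -> : (swap_omit (i, l)).1 = lift i l by [].
set l' := (swap_omit (i, l)).2; have {}h : lift (lift i l) l' = i by [].
rewrite /omit h; congr (_ *: H _ _ _); move: h; clearbody l' => h.
have := congr1 val h; rewrite /= /bump => hl.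
have := ltn_ord i; have := ltn_ord l; have := ltn_ord l'.
rewrite -!exprD -[RHS]mulN1r -exprS.
case: (leqP i l) hl => il /= hl.
  case: (leqP (1 + l) l') hl => ll /= hl; first by exfalso; lia.
  move=> *.
  rewrite (_ : (q - i + (q - l)).+1 = (q - (1 + l) + (q - l')).+2); last lia.
  by rewrite !exprS mulrA mulrNN !mul1r.
case: (leqP (0 + l) l') hl => ll /= hl; last by exfalso; lia.
by move=> *; congr (_ ^+ _); lia.
Qed.

(** * Twisted operations and the cocycle identities *)

Section Twisted.
Variables (K : fieldType) (k : nat) (L : nlieLM K k) (V W : lmodType K).
Variables (phi : {linear V -> W}).
Variables (rho1 : ('I_k.+1 -> lmg L) -> V -> V).
Variables (rho2 : ('I_k.+1 -> lmg L) -> W -> W).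
Variables (rho3 : ('I_k -> lmg L) -> lmM L -> W -> V).
Hypothesis hrep : is_LMrep phi rho1 rho2 rho3.
Variables (om : ('I_k.+2 -> lmg L) -> W) (nu : ('I_k.+1 -> lmg L) -> lmM L -> V).
Variable (th : lmM L -> W).

Local Notation sgn i := ((-1) ^+ (k.+1 - i)%N).
Local Notation g := (lmg L).
Local Notation M := (lmM L).

(* The operations of an extension read through [(x, w) |-> s0 x + i0 w] and
   [(m, v) |-> s1 m + i1 v], where [(om, nu, th)] is the cochain of [s0], [s1]. *)
Definition twisted_br (X : 'I_k.+2 -> (g * W)%type) : (g * W)%type :=
  (lmbr (fst \o X), om (fst \o X) + insert k.+1 rho2 (fst \o X) (snd \o X)).

Definition twisted_rho (X : 'I_k.+1 -> (g * W)%type) (a : (M * V)%type) :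
    (M * V)%type :=
  (lmrho (fst \o X) a.1,
   nu (fst \o X) a.1 + rho1 (fst \o X) a.2
   + insert k.+1 (fun x => rho3 x a.1) (fst \o X) (snd \o X)).

Definition twisted_f (a : (M * V)%type) : (g * W)%type :=
  (lmf L a.1, th a.1 + phi a.2).

Let lin1 x : linear (rho1 x) := rep_linear (LMrep_rho1 hrep) x.
Let lin2 x : linear (rho2 x) := rep_linear (LMrep_rho2 hrep) x.
Let lin3 x m : linear (rho3 x m) := rho3_linearW hrep x m.

Lemma insert_rho2_snoc (x : 'I_k.+1 -> g) (u : 'I_k.+1 -> W) a w :
  insert k.+1 rho2 (snoc x a) (snoc u w)
  = rho2 x w + \sum_(j < k.+1) sgn j *: rho2 (snoc (omit x j) a) (u j).
Proof.
rewrite insert_snoc subnn scale1r; congr (_ + _); apply: eq_bigr => j _.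
by rewrite omit_snoc_lift.
Qed.

(** The last slot has exponent $k+1-k=1$: this is the minus sign in the formula for the induced
    $\rho_3$. *)
Lemma insert_rho3_snoc m (x : 'I_k -> g) (u : 'I_k -> W) a w :
  insert k.+1 (fun x => rho3 x m) (snoc x a) (snoc u w)
  = \sum_(j < k) sgn j *: rho3 (omit (snoc x a) (lift ord_max j)) m (u j)
    - rho3 x m w.
Proof. by rewrite insert_snoc subSnn expr1 scaleN1r addrC. Qed.

Lemma subr_iff (Z : zmodType) (a b c d s : Z) :
  a = c + s -> b = d + s -> a = b <-> c = d.
Proof. by move=> -> ->; split=> [/addIr|->]. Qed.

(* In each of the following equivalences the parts of the two sides that involve
   the components in [W] and [V] agree by [hrep]; what remains is the cocycle
   identity. *)
Lemma twisted_fE X a :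
  (twisted_f (twisted_rho X a)).2 = (twisted_br (snoc X (twisted_f a))).2 <->
  th (lmrho (fst \o X) a.1) + phi (nu (fst \o X) a.1)
  = om (snoc (fst \o X) (lmf L a.1)) + rho2 (fst \o X) (th a.1).
Proof.
rewrite /= !comp_snoc /= insert_rho2_snoc (linD (lin2 _)) !linearD /=.
rewrite (LMrep_a hrep) (_ : phi (insert _ _ _ _) = \sum_(j < k.+1) sgn j *:
    rho2 (snoc (omit (fst \o X) j) (lmf L a.1)) (snd (X j))).
  apply: (@subr_iff _ _ _ _ _ (rho2 (fst \o X) (phi a.2) + \sum_(j < k.+1) _)).
    by rewrite -!addrA.
  by zmod_AC.
rewrite /insert linear_sum; apply: eq_bigr => i _.
by rewrite linearZ_LR /= (LMrep_b hrep).
Qed.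

Lemma twisted_brE X Y (x := fst \o X) (y := fst \o Y) :
  (twisted_br (snoc X (twisted_br Y))).2
  = (\sum_i twisted_br (setarg Y i (twisted_br (snoc X (Y i))))).2 <->
  om (snoc x (lmbr y)) + rho2 x (om y)
    = \sum_i om (setarg y i (lmbr (snoc x (y i))))
      + \sum_(i < k.+2) sgn i *: rho2 (omit y i) (om (snoc x (y i))).
Proof.
pose u := snd \o X; pose w := snd \o Y.
apply: (@subr_iff _ _ _ _ _
  (rho2 x (insert k.+1 rho2 y w)
   + \sum_(j < k.+1) sgn j *: rho2 (snoc (omit x j) (lmbr y)) (u j))).
  rewrite /= !comp_snoc /= -/x -/y -/u -/w insert_rho2_snoc (linD (lin2 _)).
  by rewrite -!addrA.
rewrite raddf_sum /=.
under eq_bigr do rewrite !comp_setarg /= !comp_snoc /= -/x -/y -/u -/w.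
rewrite big_split /= insert_setarg_sum -addrA; congr (_ + _).
(* The terms in [u] match by (R2) of [rho2], those in [w] by (R1). *)
rewrite [in RHS]/insert (lin_sum (lin2 _)).
under [X in _ + (_ + X)]eq_bigr do rewrite (rep_R2 (LMrep_rho2 hrep)) scaler_sumr.
rewrite [X in _ + (_ + X)]exchange_big -!big_split; apply: eq_bigr => i _ /=.
rewrite insert_rho2_snoc !(linD (lin2 _)) (lin_sum (lin2 _)) (linZ (lin2 _)).
rewrite (_ : \sum_j rho2 (setarg _ _ _) _
    = rho2 x (rho2 (omit y i) (w i)) - rho2 (omit y i) (rho2 x (w i)));
  last exact/esym/(rep_R1 (LMrep_rho2 hrep)).
rewrite !scalerDr scaler_sumr.
rewrite -[(Y i).1]/(y i) -[(Y i).2]/(w i) scalerN -!addrA; congr (_ + _).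
rewrite (_ : \sum_i0 _ = \sum_(i0 < k.+1) sgn i0 *: (sgn i *:
    rho2 (omit y i) (rho2 (snoc (omit x i0) (y i)) (u i0)))); first by zmod_AC.
apply: eq_bigr => j _; rewrite (linZ (lin2 _)) !scalerA; congr (_ *: _).
exact: mulrC.
Qed.

Lemma twisted_rho1E X Y a (x := fst \o X) (y := fst \o Y) :
  (twisted_rho X (twisted_rho Y a)).2
  = (twisted_rho Y (twisted_rho X a)
     + \sum_i twisted_rho (setarg Y i (twisted_br (snoc X (Y i)))) a).2 <->
  nu x (lmrho y a.1) + rho1 x (nu y a.1)
    = \sum_i nu (setarg y i (lmbr (snoc x (y i)))) a.1
      + nu y (lmrho x a.1)
      + \sum_i slot rho3 y i (om (snoc x (y i))) a.1
      + rho1 y (nu x a.1).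
Proof.
pose u := snd \o X; pose w := snd \o Y; case: a => m v /=.
pose G m := fun x => rho3 x m.
(* The terms in [v] match by (R1) of [rho1], those in [w] by axiom (c), those in [u] by axiom
   (d). *)
have Ev : rho1 x (rho1 y v) = rho1 y (rho1 x v)
    + \sum_i rho1 (setarg y i (lmbr (snoc x (y i)))) v.
  by rewrite -(rep_R1 (LMrep_rho1 hrep)) addrC subrK.
have Ew : rho1 x (insert k.+1 (G m) y w)
    = insert k.+1 (G (lmrho x m)) y w
    + \sum_(i < k.+1) sgn i *: (rho3 (omit y i) m (rho2 x (w i))
        + \sum_j rho3 (setarg (omit y i) j (lmbr (snoc x (y (lift i j))))) m (w i)).
  rewrite /insert -big_split (lin_sum (lin1 _)); apply: eq_bigr => i _ /=.
  by rewrite (linZ (lin1 _)) (LMrep_c hrep) -scalerDr -addrA.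
have Eu : insert k.+1 (G (lmrho y m)) x u
    = rho1 y (insert k.+1 (G m) x u)
    + \sum_(i < k.+1) sgn i *: rho3 (omit y i) m
        (\sum_(j < k.+1) sgn j *: rho2 (snoc (omit x j) (y i)) (u j)).
  under [X in _ + X]eq_bigr do rewrite (lin_sum (lin3 _ _)) scaler_sumr.
  rewrite exchange_big /insert (lin_sum (lin1 _)) -big_split.
  apply: eq_bigr => j _ /=; rewrite (linZ (lin1 _)) [G _ _ _](LMrep_d hrep).
  rewrite scalerDr scaler_sumr; congr (_ + _); apply: eq_bigr => i _.
  by rewrite (linZ (lin3 _ _)) !scalerA mulrC.
have Es : (\sum_i twisted_rho (setarg Y i (twisted_br (snoc X (Y i)))) (m, v)).2
    = \sum_i nu (setarg y i (lmbr (snoc x (y i)))) m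
    + \sum_i rho1 (setarg y i (lmbr (snoc x (y i)))) v
    + (\sum_i slot rho3 y i (om (snoc x (y i))) m
       + \sum_(i < k.+1) sgn i *: (rho3 (omit y i) m (rho2 x (w i))
        + \sum_j rho3 (setarg (omit y i) j (lmbr (snoc x (y (lift i j))))) m (w i))
       + \sum_(i < k.+1) sgn i *: rho3 (omit y i) m
        (\sum_(j < k.+1) sgn j *: rho2 (snoc (omit x j) (y i)) (u j))).
  rewrite raddf_sum /=.
  under eq_bigr do rewrite !comp_setarg /= !comp_snoc /= -/x -/y -/u -/w.
  rewrite big_split /= big_split /= insert_setarg_sum; congr (_ + _).
  rewrite -!big_split; apply: eq_bigr => i _ /=.
  rewrite insert_rho2_snoc !(linD (lin3 _ _)) /slot.
  rewrite -[(Y i).1]/(y i) -[(Y i).2]/(w i).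
  rewrite !scalerDr; zmod_AC.
apply: (@subr_iff _ _ _ _ _ (rho1 x (rho1 y v) + rho1 x (insert k.+1 (G m) y w)
   + insert k.+1 (G (lmrho y m)) x u)).
  by rewrite !(linD (lin1 _)); zmod_AC.
rewrite Es Ev Ew Eu !(linD (lin1 _)).
zmod_AC.
Qed.

Lemma twisted_rho2E (X : 'I_k -> (g * W)%type) Y a
    (x := fst \o X) (y := fst \o Y) :
  (twisted_rho (snoc X (twisted_br Y)) a).2
  = (\sum_(i < k.+2) sgn i *:
       twisted_rho (omit Y i) (twisted_rho (snoc X (Y i)) a)).2 <->
  nu (snoc x (lmbr y)) a.1 - rho3 x a.1 (om y)
    = \sum_(i < k.+2) sgn i *:
        (nu (omit y i) (lmrho (snoc x (y i)) a.1)
         + rho1 (omit y i) (nu (snoc x (y i)) a.1)).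
Proof.
pose u := snd \o X; pose w := snd \o Y; case: a => m v /=.
pose G m := fun x => rho3 x m.
(* The terms in [v] match by (R2) of [rho1], those in [u] by axiom (e), those in [w] by axiom
   (f). *)
have Ev : rho1 (snoc x (lmbr y)) v
    = \sum_(i < k.+2) sgn i *: rho1 (omit y i) (rho1 (snoc x (y i)) v).
  exact: rep_R2 (LMrep_rho1 hrep) _ _ _.
have Eu : \sum_(j < k) sgn j *:
      rho3 (omit (snoc x (lmbr y)) (lift ord_max j)) m (u j)
    = \sum_(i < k.+2) sgn i *: rho1 (omit y i) (\sum_(j < k) sgn j *:
      rho3 (omit (snoc x (y i)) (lift ord_max j)) m (u j)).
  under [RHS]eq_bigr do rewrite (lin_sum (lin1 _)) scaler_sumr.
  rewrite exchange_big; apply: eq_bigr => j _ /=.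
  have [x' [j' [j'k E]]] := omit_snoc_setarg x j.
  rewrite E (LMrep_e hrep) // scaler_sumr; apply: eq_bigr => i _.
  by rewrite E (linZ (lin1 _)) !scalerA mulrC.
have Ew : \sum_(i < k.+2) sgn i *:
      insert k.+1 (G (lmrho (snoc x (y i)) m)) (omit y i) (omit w i)
    = \sum_(i < k.+2) sgn i *: rho1 (omit y i) (rho3 x m (w i))
      - rho3 x m (insert k.+1 rho2 y w).
  rewrite (@insert_omit_swap _ _ _ _ _ _ (fun b => G (lmrho (snoc x b) m))) //.
  rewrite /insert (lin_sum (lin3 _ _)) -!sumrN -big_split; apply: eq_bigr => i _ /=.
  rewrite (linZ (lin3 _ _)) (LMrep_f hrep) -!scalerN -scalerDr; congr (_ *: _).
  by rewrite opprD addNKr.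
have Es : (\sum_(i < k.+2) sgn i *:
       twisted_rho (omit Y i) (twisted_rho (snoc X (Y i)) (m, v))).2
    = \sum_(i < k.+2) sgn i *:
        (nu (omit y i) (lmrho (snoc x (y i)) m)
         + rho1 (omit y i) (nu (snoc x (y i)) m))
    + \sum_(i < k.+2) sgn i *: rho1 (omit y i) (rho1 (snoc x (y i)) v)
    + \sum_(i < k.+2) sgn i *: rho1 (omit y i) (\sum_(j < k) sgn j *:
      rho3 (omit (snoc x (y i)) (lift ord_max j)) m (u j))
    - \sum_(i < k.+2) sgn i *: rho1 (omit y i) (rho3 x m (w i))
    + \sum_(i < k.+2) sgn i *:
      insert k.+1 (G (lmrho (snoc x (y i)) m)) (omit y i) (omit w i).
  rewrite raddf_sum -sumrN -!big_split; apply: eq_bigr => i _ /=.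
  rewrite !comp_snoc /= -/x -/u insert_rho3_snoc.
  rewrite -[(Y i).1]/(y i) -[(Y i).2]/(w i).
  rewrite -[fst \o omit Y i]/(omit y i) -[snd \o omit Y i]/(omit w i).
  by rewrite !(linD (lin1 _), linN (lin1 _)) !(scalerDr, scalerN); zmod_AC.
apply: (@subr_iff _ _ _ _ _ (rho1 (snoc x (lmbr y)) v
  - rho3 x m (insert k.+1 rho2 y w) + \sum_(j < k) sgn j *:
      rho3 (omit (snoc x (lmbr y)) (lift ord_max j)) m (u j))).
  rewrite !comp_snoc /= -/x -/y -/u -/w insert_rho3_snoc (linD (lin3 _ _)).
  zmod_AC.
rewrite Es Ev Eu Ew; zmod_AC.
Qed.

End Twisted.

(** * The extension built from a cocycle *)

Section Model.
Variables (K : fieldType) (k : nat) (L : nlieLM K k) (V W : lmodType K).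
Variables (phi : {linear V -> W}).
Variables (rho1 : ('I_k.+1 -> lmg L) -> V -> V).
Variables (rho2 : ('I_k.+1 -> lmg L) -> W -> W).
Variables (rho3 : ('I_k -> lmg L) -> lmM L -> W -> V).
Hypothesis hrep : is_LMrep phi rho1 rho2 rho3.
Variable c : cochain V W L.
Hypothesis coc : is_cocycle phi rho1 rho2 rho3 c.

Local Notation g := (lmg L).
Local Notation M := (lmM L).
Local Notation tbr := (twisted_br rho2 (com c)).
Local Notation trho := (twisted_rho rho1 rho3 (cnu c)).

Lemma twisted_nlie : is_nlie tbr.
Proof.
have rep2 := LMrep_rho2 hrep.
split=> [X i a u v|X i j nij eij|X Y].
- apply: injective_projections => /=.
    by rewrite !comp_setarg (nlie_multilinear (lm_nlie L)).
  rewrite (insert_multilinear _ (rep_linear rep2) (rep_multilinear rep2)).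
  by rewrite !comp_setarg (com_multilinear c) scalerDr; zmod_AC.
- have e1 : (fst \o X) i = (fst \o X) j by rewrite /= eij.
  apply: injective_projections => /=.
    exact: nlie_alternating (lm_nlie L) _ _ _ nij e1.
  rewrite (com_alternating c nij e1) add0r.
  apply: (insert_alternating (leqnn _) (rep_multilinear rep2)
    (rep_alternating rep2) nij eij).
- apply: injective_projections; last exact/(twisted_brE hrep)/(cocycle_br coc).
  rewrite raddf_sum /= comp_snoc (nlie_fundamental (lm_nlie L)).
  by apply: eq_bigr => i _; rewrite comp_setarg /= comp_snoc.
Qed.

Lemma twisted_rep : is_rep tbr trho.
Proof.
have rep1 := LMrep_rho1 hrep; have repM := lm_rep L.
have R1 X Y a : trho X (trho Y a) = trho Y (trho X a)
    + \sum_i trho (setarg Y i (tbr (snoc X (Y i)))) a.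
  apply: injective_projections; last exact/(twisted_rho1E hrep)/(cocycle_act1 coc).
  rewrite /= raddf_sum /=.
  under eq_bigr do rewrite comp_setarg /= comp_snoc.
  by rewrite -(rep_R1 repM) addrC subrK.
split=> [X a u v|a X i b u v|a X i j nij eij|X Y a|X Y a].
- apply: injective_projections => /=; first exact: (rep_linear repM).
  rewrite (cnu_linear c) (rep_linear rep1) !scalerDr.
  rewrite (_ : insert _ _ _ _
     = a *: insert k.+1 (fun x => rho3 x u.1) (fst \o X) (snd \o X)
     + insert k.+1 (fun x => rho3 x v.1) (fst \o X) (snd \o X)); first by zmod_AC.
  rewrite /insert scaler_sumr -big_split; apply: eq_bigr => i _ /=.
  by rewrite (rho3_linearM hrep) scalerDr !scalerA mulrC.
- apply: injective_projections => /=.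
    by rewrite !comp_setarg (rep_multilinear repM).
  rewrite (insert_multilinear _ (rho3_linearW hrep ^~ a.1) (rho3_multilinear hrep a.1)).
  by rewrite !comp_setarg (cnu_multilinear c) (rep_multilinear rep1) !scalerDr; zmod_AC.
- have e1 : (fst \o X) i = (fst \o X) j by rewrite /= eij.
  apply: injective_projections => /=; first exact: rep_alternating repM _ _ _ _ nij e1.
  rewrite (cnu_alternating c _ nij e1) (rep_alternating rep1 _ nij e1) !add0r.
  exact: (insert_alternating (leqnSn _) (rho3_multilinear hrep a.1)
    (rho3_alternating hrep a.1) nij eij).
- by rewrite R1 addrAC subrr add0r.
- apply: injective_projections; last exact/(twisted_rho2E hrep)/(cocycle_act2 coc).
  rewrite raddf_sum /= comp_snoc (rep_R2 repM).
  by apply: eq_bigr => i _; rewrite /= comp_snoc.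
Qed.

Lemma twisted_f_linear : linear (twisted_f phi (cth c)).
Proof.
move=> a u v; apply: injective_projections => /=; first exact: linearP.
by rewrite (cth_linear c) linearP scalerDr; zmod_AC.
Qed.

Definition twisted_f_map : {linear (M * V)%type -> (g * W)%type} :=
  HB.pack (twisted_f phi (cth c))
    (GRing.isLinear.Build K _ _ _ (twisted_f phi (cth c)) twisted_f_linear).

Lemma twisted_f_equiv X a :
  twisted_f_map (trho X a) = tbr (snoc X (twisted_f_map a)).
Proof.
apply: injective_projections; last exact/(twisted_fE hrep)/(cocycle_f coc).
by rewrite /= comp_snoc; apply: lm_equiv.
Qed.

Definition twistedLM : nlieLM K k := NLieLM twisted_nlie twisted_rep twisted_f_equiv.

(** On arguments with zero second component [insert] vanishes, so the defect of the splitting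
    [(x, 0)], [(m, 0)] from being a homomorphism is exactly [c]. *)
Lemma model_extension : exists (E : abelian_extension phi rho1 rho2 rho3)
  (s0 : g -> lmg E) (s1 : M -> lmM E),
  is_splitting s0 s1 /\ splitting_cochain s0 s1 c.
Proof.
have rep1 := LMrep_rho1 hrep; have rep2 := LMrep_rho2 hrep.
have repM := lm_rep L; have nlieg := lm_nlie L.
have br0 := multilinear_zero (nlie_multilinear nlieg).
have rhoM0 m := multilinear_zero (rep_multilinear repM m).
have om0 := multilinear_zero (com_multilinear c).
have nu0 m := multilinear_zero (@cnu_multilinear _ _ _ _ _ c m).
have rho1_0 v := multilinear_zero (rep_multilinear rep1 v).
have inr_linear (Z Z' : lmodType K) : linear (fun z : Z' => (0, z) : (Z * Z')%type).
  by move=> a u v; apply: injective_projections => //=; rewrite scaler0 addr0.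
have inl_linear (Z Z' : lmodType K) : linear (fun z : Z => (z, 0) : (Z * Z')%type).
  by move=> a u v; apply: injective_projections => //=; rewrite scaler0 addr0.
have ihom : @is_LMhom K k (abelianLM k phi) twistedLM (pair 0) (pair 0).
  split=> [||x|v|x v]; try exact: inr_linear.
  - apply: injective_projections => /=; first by rewrite (br0 _ ord0).
    rewrite (om0 _ ord0) //.
    (* The arity is at least 2, so [ord0] and [ord_max] are distinct. *)
    rewrite (@insert_zero _ _ _ _ _ _ _ _ _ ord0 ord_max (rep_multilinear rep2)) //.
    by rewrite addr0.
  - apply: injective_projections => /=; rewrite ?linear0 //.
    by rewrite (lin0 (cth_linear c)) add0r.
  - apply: injective_projections => /=; first by rewrite (rhoM0 _ _ ord0).
    rewrite (nu0 _ _ ord0) // (rho1_0 _ _ ord0) // !add0r /insert big1 // => i _.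
    by rewrite (lin0 (rho3_linearM hrep _ _)) scaler0.
(* The first components of the twisted operations are by definition the operations of [L]. *)
have phom : @is_LMhom K k twistedLM L fst fst by split.
have inr_inj (Z Z' : lmodType K) : injective (fun z : Z' => (0, z) : (Z * Z')%type).
  by move=> u v [].
have exact_pair (Z Z' : lmodType K) (a : (Z * Z')%type) :
    a.1 = 0 <-> exists z, (0, z) = a.
  by split=> [a0|[z <-] //]; exists a.2; case: a a0 => ? ? /= ->.
have fst_surj (Z Z' : lmodType K) (z : Z) : exists a : (Z * Z')%type, a.1 = z.
  by exists (z, 0).
pose E := @Extension K k L (abelianLM k phi) twistedLM _ _ _ _ ihom phom
  (@inr_inj g W) (@inr_inj M V) (@exact_pair g W) (@exact_pair M V)
  (@fst_surj g W) (@fst_surj M V).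
pose s0 (x : g) : lmg E := (x, 0); pose s1 (m : M) : lmM E := (m, 0).
have splits : is_splitting s0 s1 by split=> //; apply: inl_linear.
have idealE : is_abelian_ideal E.
  split=> [X i j w w' nij Xi Xj|X i w v Xi|X i j w w' m nij Xi Xj].
  - have xi : (fst \o X) i = 0 by rewrite /= Xi.
    have xj : (fst \o X) j = 0 by rewrite /= Xj.
    apply: injective_projections => /=; first exact: br0 xi.
    by rewrite (om0 _ _ xi) (insert_zero _ _ (rep_multilinear rep2) nij xi xj) addr0.
  - have xi : (fst \o X) i = 0 by rewrite /= Xi.
    apply: injective_projections => /=; first exact: rhoM0 xi.
    rewrite (nu0 _ _ _ xi) (rho1_0 _ _ _ xi) !add0r /insert big1 // => l _.
    by rewrite (lin0 (rho3_linearM hrep _ _)) scaler0.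
  - have xi : (fst \o X) i = 0 by rewrite /= Xi.
    have xj : (fst \o X) j = 0 by rewrite /= Xj.
    apply: injective_projections => /=; first exact: rhoM0 xi.
    rewrite (nu0 _ _ _ xi) (rho1_0 _ _ _ xi) !add0r.
    exact: (insert_zero _ _ (rho3_multilinear hrep _) nij xi xj).
have inducesE : induces rho1 rho2 rho3 E.
  exists s0, s1; split=> // [x v|x w|x m w]; apply: injective_projections => /=.
  - by rewrite (lin0 (rep_linear repM _)).
  - rewrite (lin0 (cnu_linear c _)) add0r /insert big1 ?addr0 // => l _.
    by rewrite (lin0 (rho3_linearM hrep _ _)) scaler0.
  - by rewrite comp_snoc /= (br0 _ ord_max) ?snoc_max.
  - rewrite !comp_snoc /= (om0 _ ord_max) ?snoc_max // add0r.
    rewrite (insert_rho2_snoc rho2 x (fun=> 0)) big1 ?addr0 // => j _.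
    by rewrite (lin0 (rep_linear rep2 _)) scaler0.
  - by rewrite comp_snoc /= (rhoM0 _ _ ord_max) ?snoc_max ?oppr0.
  - rewrite !comp_snoc /= (nu0 _ _ ord_max) ?snoc_max // add0r.
    rewrite (lin0 (rep_linear rep1 _)) add0r (insert_rho3_snoc rho3 m x (fun=> 0)).
    rewrite big1 ?add0r ?opprK // => j _.
    by rewrite (lin0 (rho3_linearW hrep _ _)) scaler0.
exists (AbelianExtension idealE inducesE), s0, s1; split=> //.
split=> [x|x m|m]; apply: injective_projections => /=.
- by rewrite subrr.
- by rewrite subr0 insert0 ?addr0 //; apply: rep_linear rep2.
- by rewrite subrr.
- rewrite subr0 (lin0 (rep_linear rep1 _)) addr0.
  by rewrite insert0 ?addr0 // => z; apply: rho3_linearW hrep z m.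
- by rewrite subrr.
- by rewrite linear0 addr0 subr0.
Qed.

End Model.

(** * Coordinates on an extension given by a splitting *)

Section Extensions.
Variables (K : fieldType) (k : nat) (L : nlieLM K k) (V W : lmodType K).
Variables (phi : {linear V -> W}).
Variables (rho1 : ('I_k.+1 -> lmg L) -> V -> V).
Variables (rho2 : ('I_k.+1 -> lmg L) -> W -> W).
Variables (rho3 : ('I_k -> lmg L) -> lmM L -> W -> V).
Hypothesis hrep : is_LMrep phi rho1 rho2 rho3.

Local Notation g := (lmg L).
Local Notation M := (lmM L).
Local Notation abext := (abelian_extension phi rho1 rho2 rho3).

Section Coordinates.
Variables (E : abext) (s0 : g -> lmg E) (s1 : M -> lmM E).
Hypothesis splits : is_splitting s0 s1.

Local Notation i0 := (ext_i0 E : W -> lmg E).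
Local Notation i1 := (ext_i1 E : V -> lmM E).

Let lin_i0 : linear i0 := hom_linear0 (ext_ihom E).
Let lin_i1 : linear i1 := hom_linear1 (ext_ihom E).
Let lin_p0 : linear (@ext_p0 _ _ _ _ E) := hom_linear0 (ext_phom E).
Let lin_p1 : linear (@ext_p1 _ _ _ _ E) := hom_linear1 (ext_phom E).
Let lin_s0 : linear s0 := splitting_linear0 splits.
Let lin_s1 : linear s1 := splitting_linear1 splits.

Lemma ext_p0_i0 w : ext_p0 (i0 w) = 0.
Proof. by apply/(ext_exact0 (e := E)); exists w. Qed.

Lemma ext_p1_i1 v : ext_p1 (i1 v) = 0.
Proof. by apply/(ext_exact1 (e := E)); exists v. Qed.

(** Exactness and choice. The components $\omega$ and $\theta$, the $W$-coordinate and the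
    difference of two splittings all arise this way. *)
Lemma ext_lift0 (T : Type) (a b : T -> lmg E) :
  (forall x, ext_p0 (a x) = ext_p0 (b x)) ->
  exists w : T -> W, forall x, i0 (w x) = a x - b x.
Proof.
move=> eab; have ex x : exists w, i0 w = a x - b x.
  by apply/(ext_exact0 (e := E)); rewrite (linB lin_p0) eab subrr.
by have [w wE] := choice ex; exists w.
Qed.

Lemma ext_lift1 (T : Type) (a b : T -> lmM E) :
  (forall x, ext_p1 (a x) = ext_p1 (b x)) ->
  exists v : T -> V, forall x, i1 (v x) = a x - b x.
Proof.
move=> eab; have ex x : exists v, i1 v = a x - b x.
  by apply/(ext_exact1 (e := E)); rewrite (linB lin_p1) eab subrr.
by have [v vE] := choice ex; exists v.
Qed.

(* [aext_induces] gives the next three formulas for one splitting only; the ideal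
   conditions extend them to all splittings. *)
Lemma splitting_rho1 x v : lmrho (s0 \o x) (i1 v) = i1 (rho1 x v).
Proof.
have [t0 [t1 [[_ _ t0K _] -> _ _]]] := aext_induces E.
have [b bE] : exists b : g -> W, forall y, i0 (b y) = s0 y - t0 y.
  by apply: ext_lift0 => y; rewrite t0K (splitting_p0 splits).
have -> : s0 \o x = fun i => (t0 \o x) i + i0 (b (x i)).
  by apply/funext => i; rewrite /= bE addrC subrK.
apply: (@multilinear_absorb _ _ _ _ (fun X => lmrho X (i1 v))
  (fun a => exists w, a = i0 w)).
- exact: rep_multilinear (lm_rep E) _.
- by move=> X i [w Xi]; apply: (ideal_WV (aext_ideal E) _ Xi).
- by move=> i; exists (b (x i)).
Qed.

Lemma splitting_rho2 x w : lmbr (snoc (s0 \o x) (i0 w)) = i0 (rho2 x w).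
Proof.
have [t0 [t1 [[_ _ t0K _] _ -> _]]] := aext_induces E.
have [b bE] : exists b : g -> W, forall y, i0 (b y) = s0 y - t0 y.
  by apply: ext_lift0 => y; rewrite t0K (splitting_p0 splits).
have -> : s0 \o x = fun i => (t0 \o x) i + i0 (b (x i)).
  by apply/funext => i; rewrite /= bE addrC subrK.
apply: (@multilinear_absorb _ _ _ _ (fun X => lmbr (snoc X (i0 w)))
  (fun a => exists w, a = i0 w)).
- exact/multilinear_snoc/(nlie_multilinear (lm_nlie E)).
- move=> X i [w' Xi].
  apply: (ideal_WW (aext_ideal E) (i := lift ord_max i) (j := ord_max)
    (w := w') (w' := w)).
  + by rewrite eq_sym neq_lift.
  + by rewrite snoc_lift.
  + by rewrite snoc_max.
- by move=> i; exists (b (x i)).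
Qed.

Lemma splitting_rho3 x m w :
  lmrho (snoc (s0 \o x) (i0 w)) (s1 m) = - i1 (rho3 x m w).
Proof.
have [t0 [t1 [[_ _ t0K t1K] _ _ ->]]] := aext_induces E; rewrite opprK.
have [b bE] : exists b : g -> W, forall y, i0 (b y) = s0 y - t0 y.
  by apply: ext_lift0 => y; rewrite t0K (splitting_p0 splits).
have [v vE] : exists v : M -> V, forall m, i1 (v m) = s1 m - t1 m.
  by apply: ext_lift1 => y; rewrite t1K (splitting_p1 splits).
(* Here [s1] changes as well; the difference lies in $V$, where an entry of $W$ acts as zero. *)
rewrite -[s1 m](subrK (t1 m)) -vE (linD (rep_linear (lm_rep E) _)).
rewrite (ideal_WV (aext_ideal E) (i := ord_max) (w := w)) ?snoc_max // add0r.
have -> : s0 \o x = fun i => (t0 \o x) i + i0 (b (x i)).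
  by apply/funext => i; rewrite /= bE addrC subrK.
apply: (@multilinear_absorb _ _ _ _ (fun X => lmrho (snoc X (i0 w)) (t1 m))
  (fun a => exists w, a = i0 w)).
- by apply: (multilinear_snoc (F := fun X => lmrho X (t1 m)));
    apply: (rep_multilinear (lm_rep E)).
- move=> X i [w' Xi].
  apply: (ideal_WWM (aext_ideal E) (i := lift ord_max i) (j := ord_max)
    (w := w') (w' := w)).
  + by rewrite eq_sym neq_lift.
  + by rewrite snoc_lift.
  + by rewrite snoc_max.
- by move=> i; exists (b (x i)).
Qed.

(** The projection is a homomorphism, so the defects of the splitting vanish under it and lift to
    $W$ and $V$; linearity and alternation descend through the injections. *)
Lemma splitting_cochain_exists : exists c : cochain V W L, splitting_cochain s0 s1 c.
Proof.
have [om omE] : exists om, forall x, i0 (om x) = lmbr (s0 \o x) - s0 (lmbr x).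
  apply: (@ext_lift0 _ (fun x => lmbr (s0 \o x)) (fun x => s0 (lmbr x))) => x.
  rewrite (hom_br (ext_phom E)) (splitting_p0 splits); congr lmbr.
  by apply/funext => i; apply: (splitting_p0 splits).
have [nu nuE] : exists nu, forall p : ('I_k.+1 -> g) * M,
    i1 (nu p) = lmrho (s0 \o p.1) (s1 p.2) - s1 (lmrho p.1 p.2).
  apply: (@ext_lift1 _ (fun p : ('I_k.+1 -> g) * M => lmrho (s0 \o p.1) (s1 p.2))
    (fun p => s1 (lmrho p.1 p.2))) => -[x m] /=.
  rewrite (hom_rho (ext_phom E)) !(splitting_p1 splits); congr lmrho.
  by apply/funext => i; apply: (splitting_p0 splits).
have [th thE] : exists th, forall m, i0 (th m) = lmf E (s1 m) - s0 (lmf L m).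
  apply: (@ext_lift0 _ (fun m => lmf E (s1 m)) (fun m => s0 (lmf L m))) => m.
  by rewrite -(hom_f (ext_phom E)) (splitting_p0 splits) (splitting_p1 splits).
have lin_id (Z : lmodType K) : linear (@id Z) by [].
have linE := rep_linear (lm_rep E); have linM := rep_linear (lm_rep L).
have mulom : multilinear om.
  move=> x i; apply: (linear_can _ lin_i0 (@ext_i0_inj _ _ _ _ E)
    (fun u => omE (setarg x i u))).
  apply: linear_sub.
    exact: (multilinear_comp lin_s0 (lin_id _) (nlie_multilinear (lm_nlie E))).
  exact: (multilinear_comp (lin_id _) lin_s0 (nlie_multilinear (lm_nlie L))).
have altom : alternating om.
  move=> x i j nij xij; apply: (@ext_i0_inj _ _ _ _ E).
  rewrite omE (nlie_alternating (lm_nlie L) nij xij).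
  rewrite (nlie_alternating (lm_nlie E) nij) ?(lin0 lin_i0) ?(lin0 lin_s0) ?subrr //.
  by rewrite /= xij.
have mulnu m : multilinear (fun x => nu (x, m)).
  move=> x i; apply: (linear_can _ lin_i1 (@ext_i1_inj _ _ _ _ E)
    (fun u => nuE (setarg x i u, m))).
  apply: linear_sub.
    exact: (multilinear_comp lin_s0 (lin_id _) (rep_multilinear (lm_rep E) (s1 m))).
  exact: (multilinear_comp (lin_id _) lin_s1 (rep_multilinear (lm_rep L) m)).
have altnu m : alternating (fun x => nu (x, m)).
  move=> x i j nij xij; apply: (@ext_i1_inj _ _ _ _ E).
  rewrite nuE /= (rep_alternating (lm_rep L) _ nij xij).
  rewrite (rep_alternating (lm_rep E) _ nij) ?(lin0 lin_i1) ?(lin0 lin_s1) ?subrr //.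
  by rewrite /= xij.
have linnu x : linear (fun m => nu (x, m)).
  apply: (linear_can _ lin_i1 (@ext_i1_inj _ _ _ _ E) (fun m => nuE (x, m))).
  by apply: linear_sub => a u v /=; rewrite ?lin_s1 ?linE // linM lin_s1.
have linth : linear th.
  apply: (linear_can _ lin_i0 (@ext_i0_inj _ _ _ _ E) thE).
  by apply: linear_sub => a u v; rewrite ?lin_s1 linearP ?lin_s0.
exists (Cochain mulom altom mulnu altnu linnu linth).
by split=> [x|x m|m] /=; rewrite ?omE ?nuE ?thE.
Qed.

Definition frame0 (a : (g * W)%type) : lmg E := s0 a.1 + i0 a.2.
Definition frame1 (a : (M * V)%type) : lmM E := s1 a.1 + i1 a.2.

Lemma frame0_linear : linear frame0.
Proof. by move=> a u v; rewrite /frame0 /= lin_s0 lin_i0 scalerDr; zmod_AC. Qed.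

Lemma frame1_linear : linear frame1.
Proof. by move=> a u v; rewrite /frame1 /= lin_s1 lin_i1 scalerDr; zmod_AC. Qed.

Lemma ext_p0_frame0 a : ext_p0 (frame0 a) = a.1.
Proof. by rewrite (linD lin_p0) ext_p0_i0 addr0 (splitting_p0 splits). Qed.

Lemma ext_p1_frame1 a : ext_p1 (frame1 a) = a.1.
Proof. by rewrite (linD lin_p1) ext_p1_i1 addr0 (splitting_p1 splits). Qed.

Lemma frame0_inj : injective frame0.
Proof.
move=> a b eab; have e1 : a.1 = b.1 by rewrite -!ext_p0_frame0 eab.
apply: injective_projections => //; move: eab; rewrite /frame0 e1 => /addrI.
exact: (@ext_i0_inj _ _ _ _ E).
Qed.

Lemma frame1_inj : injective frame1.
Proof.
move=> a b eab; have e1 : a.1 = b.1 by rewrite -!ext_p1_frame1 eab.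
apply: injective_projections => //; move: eab; rewrite /frame1 e1 => /addrI.
exact: (@ext_i1_inj _ _ _ _ E).
Qed.

Lemma frame0_bij : exists d, cancel d frame0 /\ cancel frame0 d.
Proof.
have [w wE] : exists w : lmg E -> W, forall a, i0 (w a) = a - s0 (ext_p0 a).
  by apply: ext_lift0 => a; rewrite (splitting_p0 splits).
have dK : cancel (fun a => (ext_p0 a, w a)) frame0.
  by move=> a; rewrite /frame0 /= wE addrC subrK.
by exists (fun a => (ext_p0 a, w a)); split=> // a; apply: frame0_inj; rewrite dK.
Qed.

Lemma frame1_bij : exists d, cancel d frame1 /\ cancel frame1 d.
Proof.
have [v vE] : exists v : lmM E -> V, forall a, i1 (v a) = a - s1 (ext_p1 a).
  by apply: ext_lift1 => a; rewrite (splitting_p1 splits).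
have dK : cancel (fun a => (ext_p1 a, v a)) frame1.
  by move=> a; rewrite /frame1 /= vE addrC subrK.
by exists (fun a => (ext_p1 a, v a)); split=> // a; apply: frame1_inj; rewrite dK.
Qed.

Section TwistedCoordinates.
Variable c : cochain V W L.
Hypothesis sc : splitting_cochain s0 s1 c.

(** Terms with two entries of $W$ vanish by [ideal_WW]. In a term with one, alternation moves it
    last, which yields the signs of [insert]. *)
Lemma frame_br X : lmbr (frame0 \o X) = frame0 (twisted_br rho2 (com c) X).
Proof.
have [omE _ _] := sc; have mulE := nlie_multilinear (lm_nlie E).
have altE := nlie_alternating (lm_nlie E).
have -> : frame0 \o X = fun i => (s0 \o (fst \o X)) i + i0 (X i).2 by [].
rewrite (@multilinear_expand _ _ _ _ (@lmbr K k E) (fun a => exists w, a = i0 w)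
  (s0 \o (fst \o X)) (fun i => i0 (X i).2) mulE).
- rewrite /frame0 /= (linD lin_i0) omE addrA [s0 _ + _]addrC subrK; congr (_ + _).
  rewrite (lin_sum lin_i0); apply: eq_bigr => i _.
  rewrite (alternating_last mulE altE _ i) setarg_eq setarg_omit.
  by rewrite (linZ lin_i0) -splitting_rho2.
- by move=> x i j nij [w xi] [w' xj];
    apply: ideal_WW (aext_ideal E) _ _ _ _ _ nij xi xj.
- by move=> i; exists (X i).2.
Qed.

Lemma frame_rho X a :
  lmrho (frame0 \o X) (frame1 a) = frame1 (twisted_rho rho1 rho3 (cnu c) X a).
Proof.
have [_ nuE _] := sc; have mulE := rep_multilinear (lm_rep E).
have altE := rep_alternating (lm_rep E).
rewrite /frame1 (linD (rep_linear (lm_rep E) _)).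
have -> : frame0 \o X = fun i => (s0 \o (fst \o X)) i + i0 (X i).2 by [].
rewrite (@multilinear_absorb _ _ _ _ (fun X => lmrho X (i1 a.2))
  (fun a => exists w, a = i0 w) (s0 \o (fst \o X)) (fun i => i0 (X i).2) (mulE _)).
- rewrite splitting_rho1.
  rewrite (@multilinear_expand _ _ _ _ (fun X => lmrho X (s1 a.1))
    (fun a => exists w, a = i0 w) (s0 \o (fst \o X)) (fun i => i0 (X i).2) (mulE _)).
  + rewrite /= !(linD lin_i1) nuE (lin_sum lin_i1).
    rewrite (_ : \sum_i lmrho _ _ = \sum_(i < k.+1)
      i1 ((-1) ^+ (k.+1 - i) *: rho3 (omit (fst \o X) i) a.1 ((snd \o X) i))).
      by zmod_AC.
    apply: eq_bigr => i _.
    rewrite (alternating_last (mulE _) (altE _) _ i) setarg_eq setarg_omit.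
    have -> : omit (s0 \o (fst \o X)) i = s0 \o omit (fst \o X) i by [].
    (* Moving the entry last costs [k - i] transpositions; the minus sign of the induced [rho3]
       supplies the missing factor. *)
    have -> : (k.+1 - i = (k - i).+1)%N by rewrite subSn // -ltnS.
    by rewrite splitting_rho3 (linZ lin_i1) exprS mulN1r scaleNr scalerN.
  + by move=> x i j nij [w xi] [w' xj];
      apply: ideal_WWM (aext_ideal E) _ _ _ _ _ _ nij xi xj.
  + by move=> i; exists (X i).2.
- by move=> x i [w xi]; apply: ideal_WV (aext_ideal E) _ _ _ _ xi.
- by move=> i; exists (X i).2.
Qed.

Lemma frame_f a : lmf E (frame1 a) = frame0 (twisted_f phi (cth c) a).
Proof.
have [_ _ thE] := sc; rewrite /frame1 /frame0 linearD (linD lin_i0) thE.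
rewrite (_ : lmf E (i1 a.2) = i0 (phi a.2)); last exact: (hom_f (ext_ihom E)).
by rewrite /=; zmod_AC.
Qed.

(** The axioms of [E], read in coordinates, are the twisted identities; evaluated at [(x, 0)] and
    [(m, 0)] they yield the cocycle identities by the four equivalences. *)
Lemma splitting_cochain_cocycle : is_cocycle phi rho1 rho2 rho3 c.
Proof.
have lin_c0 := frame0_linear; have lin_c1 := frame1_linear.
pose z0 n (x : 'I_n -> g) (i : 'I_n) : (g * W)%type := (x i, 0).
have e0snoc n (X : 'I_n -> (g * W)%type) a :
  snoc (frame0 \o X) (frame0 a) = frame0 \o snoc X a by rewrite comp_snoc.
have e0set n (X : 'I_n -> (g * W)%type) i a :
  setarg (frame0 \o X) i (frame0 a) = frame0 \o setarg X i a by rewrite comp_setarg.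
split=> [x m|x y|x y m|x y m].
- apply/(twisted_fE hrep _ _ _ (z0 _ x) (m, 0)).
  congr snd; apply: frame0_inj; rewrite -frame_f -frame_rho -frame_br -e0snoc.
  by rewrite lm_equiv frame_f.
- apply/(twisted_brE hrep _ (z0 _ x) (z0 _ y)); congr snd; apply: frame0_inj.
  rewrite (lin_sum lin_c0) -frame_br -e0snoc -frame_br (nlie_fundamental (lm_nlie E)).
  by apply: eq_bigr => i _; rewrite -frame_br -e0set -frame_br -e0snoc.
- apply/(twisted_rho1E hrep _ _ (z0 _ x) (z0 _ y) (m, 0)); congr snd; apply: frame1_inj.
  rewrite (linD lin_c1) (lin_sum lin_c1) -!frame_rho.
  apply/eqP; rewrite addrC -subr_eq (rep_R1 (lm_rep E)); apply/eqP.
  by apply: eq_bigr => i _; rewrite -frame_rho -e0set -frame_br -e0snoc.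
- apply/(twisted_rho2E hrep _ _ (z0 _ x) (z0 _ y) (m, 0)); congr snd; apply: frame1_inj.
  rewrite (lin_sum lin_c1) -frame_rho -e0snoc -frame_br (rep_R2 (lm_rep E)).
  by apply: eq_bigr => i _; rewrite (linZ lin_c1) -!frame_rho -e0snoc.
Qed.

(** In the coordinates of [s0], [s1] the new splitting is the graph of [b0], [b1]. The twisted
    operations on this graph have defect $c+D(b_0,b_1)$: the sums in the coboundary are [insert]
    evaluated at the values of [b0]. *)
Lemma change_splitting (b0 : g -> W) (b1 : M -> V) (t0 : g -> lmg E)
    (t1 : M -> lmM E) (c' : cochain V W L) :
  (forall x, i0 (b0 x) = t0 x - s0 x) -> (forall m, i1 (b1 m) = t1 m - s1 m) ->
  splitting_cochain t0 t1 c' <->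
  [/\ forall x, com c' x - com c x = Dom rho2 b0 x,
      forall x m, cnu c' x m - cnu c x m = Dnu rho1 rho3 b0 b1 x m
    & forall m, cth c' m - cth c m = Dth phi b0 b1 m].
Proof.
move=> b0E b1E; pose X n (x : 'I_n -> g) i := (x i, b0 (x i)).
have t0E x : t0 x = frame0 (x, b0 x) by rewrite /frame0 /= b0E addrC subrK.
have t1E m : t1 m = frame1 (m, b1 m) by rewrite /frame1 /= b1E addrC subrK.
have t0X n (x : 'I_n -> g) : t0 \o x = frame0 \o X n x.
  by apply/funext => i; rewrite /= t0E.
have brE x : lmbr (t0 \o x) - t0 (lmbr x) = i0 (com c x + Dom rho2 b0 x).
  rewrite t0X frame_br t0E /Dom addrA (linB lin_i0) -(linB frame0_linear) /frame0 /=.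
  by rewrite subrr (lin0 lin_s0) add0r -(linB lin_i0).
have rhoE x m : lmrho (t0 \o x) (t1 m) - t1 (lmrho x m)
    = i1 (cnu c x m + Dnu rho1 rho3 b0 b1 x m).
  rewrite t0X !t1E frame_rho -(linB frame1_linear) /frame1 /= subrr (lin0 lin_s1) add0r.
  by congr i1; rewrite /Dnu; zmod_AC.
have fE m : lmf E (t1 m) - t0 (lmf L m) = i0 (cth c m + Dth phi b0 b1 m).
  rewrite t0E t1E frame_f -(linB frame0_linear) /frame0 /= subrr (lin0 lin_s0) add0r.
  by rewrite /Dth addrA.
have subE (Z : zmodType) (a b d : Z) : a - b = d <-> a = b + d.
  by split=> [<-|->]; rewrite ?[b + _]addrC ?subrK ?addrK.
split=> [[h1 h2 h3]|[h1 h2 h3]]; split=> [x|x m|m].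
- by apply/subE/(@ext_i0_inj _ _ _ _ E); rewrite h1.
- by apply/subE/(@ext_i1_inj _ _ _ _ E); rewrite h2.
- by apply/subE/(@ext_i0_inj _ _ _ _ E); rewrite h3.
- by rewrite brE; congr i0; apply/subE.
- by rewrite rhoE; congr i1; apply/subE.
- by rewrite fE; congr i0; apply/subE.
Qed.

End TwistedCoordinates.
End Coordinates.
End Extensions.

(** * Equivalent extensions and cohomologous cocycles *)

Section Classification.
Variables (K : fieldType) (k : nat) (L : nlieLM K k) (V W : lmodType K).
Variables (phi : {linear V -> W}).
Variables (rho1 : ('I_k.+1 -> lmg L) -> V -> V).
Variables (rho2 : ('I_k.+1 -> lmg L) -> W -> W).
Variables (rho3 : ('I_k -> lmg L) -> lmM L -> W -> V).

Local Notation g := (lmg L).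
Local Notation M := (lmM L).
Local Notation abext := (abelian_extension phi rho1 rho2 rho3).

(** In either frame the operations are the same twisted ones, so reading coordinates in [E] and
    writing them in [E'] is a homomorphism. *)
Lemma ext_equiv_same_cochain (E E' : abext) (s0 : g -> lmg E) (s1 : M -> lmM E)
    (t0 : g -> lmg E') (t1 : M -> lmM E') (c : cochain V W L) :
  is_splitting s0 s1 -> splitting_cochain s0 s1 c ->
  is_splitting t0 t1 -> splitting_cochain t0 t1 c -> ext_equiv E E'.
Proof.
move=> ss sc ts tc.
have [d0 [d0K K0d]] := frame0_bij ss; have [d1 [d1K K1d]] := frame1_bij ss.
have lin_c0 := frame0_linear ss; have lin_c1 := frame1_linear ss.
have lin_c0' := frame0_linear ts; have lin_c1' := frame1_linear ts.
have lin_id (Z : lmodType K) : linear (@id Z) by [].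
have lin_d0 := linear_can (lin_id _) lin_c0 (frame0_inj ss) d0K.
have lin_d1 := linear_can (lin_id _) lin_c1 (frame1_inj ss) d1K.
have dX n (X : 'I_n -> lmg E) : X = frame0 s0 \o (d0 \o X).
  by apply/funext => i; rewrite /= d0K.
exists (frame0 t0 \o d0), (frame1 t1 \o d1); split=> [|w|v|a|a] /=.
- split=> [a u v|a u v|X|m|X m] /=.
  + by rewrite lin_d0 lin_c0'.
  + by rewrite lin_d1 lin_c1'.
  + by rewrite {1}(dX _ X) (frame_br ss sc) K0d -(frame_br ts tc).
  + by rewrite (frame_f tc) -{2}[m]d1K (frame_f sc) K0d.
  + rewrite {1}(dX _ X) -{1}[m]d1K (frame_rho ss sc) K1d.
    by rewrite -(frame_rho ts tc).
- have -> : ext_i0 E w = frame0 s0 (0, w).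
    by rewrite /frame0 /= (lin0 (splitting_linear0 ss)) add0r.
  by rewrite K0d /frame0 /= (lin0 (splitting_linear0 ts)) add0r.
- have -> : ext_i1 E v = frame1 s1 (0, v).
    by rewrite /frame1 /= (lin0 (splitting_linear1 ss)) add0r.
  by rewrite K1d /frame1 /= (lin0 (splitting_linear1 ts)) add0r.
- by rewrite (ext_p0_frame0 ts) -(ext_p0_frame0 ss) d0K.
- by rewrite (ext_p1_frame1 ts) -(ext_p1_frame1 ss) d1K.
Qed.

(** An equivalence carries defects to defects and fixes $V$ and $W$, so the image of the splitting
    has the same cochain. *)
Lemma ext_equiv_push (E E' : abext) (s0 : g -> lmg E) (s1 : M -> lmM E)
    (c : cochain V W L) :
  ext_equiv E E' -> is_splitting s0 s1 -> splitting_cochain s0 s1 c ->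
  exists (t0 : g -> lmg E') (t1 : M -> lmM E'),
    is_splitting t0 t1 /\ splitting_cochain t0 t1 c.
Proof.
move=> [F0 [F1 [homF F0i F1i pF0 pF1]]] [lin_s0 lin_s1 s0K s1K] [omE nuE thE].
have lin_F0 := hom_linear0 homF; have lin_F1 := hom_linear1 homF.
exists (F0 \o s0), (F1 \o s1); split.
  split=> [a u v|a u v|x|m] /=; first by rewrite lin_s0 lin_F0.
  - by rewrite lin_s1 lin_F1.
  - by rewrite pF0.
  - by rewrite pF1.
split=> [x|x m|m].
- by rewrite -F0i omE (linB lin_F0) (hom_br homF).
- by rewrite -F1i nuE (linB lin_F1) (hom_rho homF).
- by rewrite -F0i thE (linB lin_F0) /= (hom_f homF).
Qed.

Lemma cohomologous_splitting (E : abext) (s0 : g -> lmg E) (s1 : M -> lmM E)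
    (c c' : cochain V W L) :
  is_splitting s0 s1 -> splitting_cochain s0 s1 c ->
  cohomologous phi rho1 rho2 rho3 c c' <->
  exists (t0 : g -> lmg E) (t1 : M -> lmM E),
    is_splitting t0 t1 /\ splitting_cochain t0 t1 c'.
Proof.
move=> ss sc.
have lin_i0 := hom_linear0 (ext_ihom E); have lin_i1 := hom_linear1 (ext_ihom E).
split=> [[b0 [b1 cc']]|[t0 [t1 [ts tc]]]].
  pose t0 x := s0 x + ext_i0 E (b0 x); pose t1 m := s1 m + ext_i1 E (b1 m).
  exists t0, t1; split; first split=> [a u v|a u v|x|m].
  - by rewrite /t0 (splitting_linear0 ss) linearP lin_i0 scalerDr; zmod_AC.
  - by rewrite /t1 (splitting_linear1 ss) linearP lin_i1 scalerDr; zmod_AC.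
  - by rewrite (linD (hom_linear0 (ext_phom E))) ext_p0_i0 addr0 (splitting_p0 ss).
  - by rewrite (linD (hom_linear1 (ext_phom E))) ext_p1_i1 addr0 (splitting_p1 ss).
  apply/(change_splitting ss sc c' (b0 := b0) (b1 := b1)) => // [x|m].
    by rewrite /t0 addrAC subrr add0r.
  by rewrite /t1 addrAC subrr add0r.
have [b0 b0E] : exists b0 : g -> W, forall x, ext_i0 E (b0 x) = t0 x - s0 x.
  by apply: ext_lift0 => x; rewrite (splitting_p0 ts) (splitting_p0 ss).
have [b1 b1E] : exists b1 : M -> V, forall m, ext_i1 E (b1 m) = t1 m - s1 m.
  by apply: ext_lift1 => m; rewrite (splitting_p1 ts) (splitting_p1 ss).
have lin_b0 : linear b0.
  apply: (linear_can _ lin_i0 (@ext_i0_inj _ _ _ _ E) b0E).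
  exact: linear_sub (splitting_linear0 ts) (splitting_linear0 ss).
have lin_b1 : linear b1.
  apply: (linear_can _ lin_i1 (@ext_i1_inj _ _ _ _ E) b1E).
  exact: linear_sub (splitting_linear1 ts) (splitting_linear1 ss).
pose B0 : {linear g -> W} := HB.pack b0 (GRing.isLinear.Build K _ _ _ b0 lin_b0).
pose B1 : {linear M -> V} := HB.pack b1 (GRing.isLinear.Build K _ _ _ b1 lin_b1).
exists B0, B1; exact/(change_splitting ss sc c' b0E b1E).
Qed.

Lemma ext_equiv_cohomologous (E E' : abext) (s0 : g -> lmg E) (s1 : M -> lmM E)
    (t0 : g -> lmg E') (t1 : M -> lmM E') (c c' : cochain V W L) :
  is_splitting s0 s1 -> splitting_cochain s0 s1 c ->
  is_splitting t0 t1 -> splitting_cochain t0 t1 c' ->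
  ext_equiv E E' <-> cohomologous phi rho1 rho2 rho3 c c'.
Proof.
move=> ss sc ts tc; split=> [eEE'|/(cohomologous_splitting _ ss sc)].
  have [r0 [r1 [rs rc]]] := ext_equiv_push eEE' ss sc.
  by apply/(cohomologous_splitting _ rs rc); exists t0, t1.
by move=> [r0 [r1 [rs rc]]]; apply: ext_equiv_same_cochain rs rc ts tc.
Qed.

End Classification.

(* A bijection from equivalence classes of abelian extensions to H^2, under
   which the class of E corresponds to the class of the cocycle given by any
   splitting of E. *)
Theorem theorem4p4 (K : fieldType) (k : nat) (L : nlieLM K k)
    (V W : lmodType K) (phi : {linear V -> W})
    (rho1 : ('I_k.+1 -> lmg L) -> V -> V)
    (rho2 : ('I_k.+1 -> lmg L) -> W -> W)
    (rho3 : ('I_k -> lmg L) -> lmM L -> W -> V)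
    (hrep : is_LMrep phi rho1 rho2 rho3) :
  exists Phi : extension_class phi rho1 rho2 rho3 -> H2 phi rho1 rho2 rho3,
    bijective Phi /\
    forall (A : extension_class phi rho1 rho2 rho3)
      (E : abelian_extension phi rho1 rho2 rho3)
      (s0 : lmg L -> lmg E) (s1 : lmM L -> lmM E)
      (c : cocycle phi rho1 rho2 rho3),
      sval A E -> is_splitting s0 s1 -> splitting_cochain s0 s1 (sval c) ->
      sval (Phi A) c.
Proof.
(* All splittings are allowed at once, so no representative is chosen. *)
pose S (E : abelian_extension phi rho1 rho2 rho3) (c : cocycle phi rho1 rho2 rho3) :=
  exists (s0 : lmg L -> lmg E) (s1 : lmM L -> lmM E),
    is_splitting s0 s1 /\ splitting_cochain s0 s1 (sval c).
have surjS c : exists E, S E c.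
  by have [E [s0 [s1 h]]] := model_extension hrep (svalP c); exists E, s0, s1.
have cohP E c c' : S E c ->
    cohomologous phi rho1 rho2 rho3 (sval c) (sval c') <-> S E c'.
  by move=> [s0 [s1 [ss sc]]]; apply: cohomologous_splitting ss sc.
have [|c c'|c1 c2 c3|E||E E' c c'|Phi [bijPhi PhiE]] := classes_bijection
  (R := fun E E' : abelian_extension phi rho1 rho2 rho3 => ext_equiv E E')
  (R' := fun c c' : cocycle phi rho1 rho2 rho3 =>
           cohomologous phi rho1 rho2 rho3 (sval c) (sval c')) (S := S).
(* The class of a cocycle is the set of cocycles of all splittings of one extension; the three
   equivalence laws follow from this. *)
- by move=> c; have [E Ec] := surjS c; apply/(cohP _ _ _ Ec).
- have [E Ec] := surjS c.
  by move=> /(cohP _ _ _ Ec) Ec'; apply/(cohP _ _ _ Ec').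
- have [E Ec1] := surjS c1; move=> /(cohP _ _ _ Ec1) Ec2 /(cohP _ _ _ Ec2) Ec3.
  exact/(cohP _ _ _ Ec1).
(* The condition that [E] induces the given representation supplies a splitting. *)
- have [s0 [s1 [ss _ _ _]]] := aext_induces E.
  have [c sc] := splitting_cochain_exists ss.
  by exists (exist _ c (splitting_cochain_cocycle hrep ss sc)), s0, s1.
- exact: surjS.
- move=> [s0 [s1 [ss sc]]] [t0 [t1 [ts tc]]].
  exact: ext_equiv_cohomologous ss sc ts tc.
exists Phi; split=> // A E s0 s1 c AE ss sc.
by apply: PhiE AE _; exists s0, s1.
Qed.
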